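(* Let $N$ and $H$ be torsion-free and countable discrete groups with $N$ Abelian. Additionally, suppose that $H$ is amenable and let $G$ be a central extension of $H$ by $N$. If $H$ satisfies the Kadison-Kaplansky conjecture, then so does the group $G$.
   Context: A central extension of $H$ by $N$ is a group $G$ fitting into a short exact sequence $1\to N\to G\to H\to 1$ such that (the image of) $N$ is contained in the center of $G$. A torsion-free discrete group $\Gamma$ is said to satisfy the Kadison-Kaplansky conjecture if its reduced group C$^*$-algebra contains no idempotents other than $0$ and the identity. For amenable groups (in particular for the groups $H$ and $G$ here) the reduced group C$^*$-algebra coincides with the full group C$^*$-algebra $C^*(\Gamma)$, the universal enveloping C$^*$-algebra of $\mathbb{C}[\Gamma]$ with the $\ell^1$-norm and the involution $\big(\sum_g f_g\delta_g\big)^*=\sum_g\overline{f_g}\,\delta_{g^{-1}}$. *)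

(* Defs.v *)
From HB Require Import structures.
From mathcomp Require Import all_boot all_order all_algebra.
From mathcomp Require Import finmap complex ring.
From mathcomp Require Import all_classical all_reals.
From mathcomp Require Import ereal esum.

Set Implicit Arguments.
Unset Strict Implicit.
Unset Printing Implicit Defensive.

Import Order.TTheory GRing.Theory Num.Theory.
Import Normc.

Local Open Scope classical_set_scope.
Local Open Scope ring_scope.

Definition torsion_free (G : groupType) : Prop :=
  forall (g : G) (n : nat), (0 < n)%N -> (g ^+ n = 1)%g -> g = 1%g.

Definition abelian_group (G : groupType) : Prop :=
  commutative (fun x y : G => (x * y)%g).

(* 1 -> N -> G -> H -> 1 is exact and the image of N is central in G. *)
Definition is_central_extension (N H G : groupType) : Prop :=
  exists (i : {multiplicative N -> G}) (p : {multiplicative G -> H}),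
    [/\ injective i,
        range i = p @^-1` [set 1%g],
        range p = [set: H]
      & forall (n : N) (g : G), (i n * g = g * i n)%g].

Definition bounded_function (R : realType) (T : Type) (u : T -> R) : Prop :=
  exists M : R, forall t, `|u t| <= M.

(* A mean is a positive normalised linear functional on the bounded functions;
   [m] is total, but its values on unbounded functions are unconstrained. *)
Definition left_invariant_mean (R : realType) (G : groupType)
    (m : (G -> R) -> R) : Prop :=
  [/\ forall (a : R) (u v : G -> R),
        bounded_function u -> bounded_function v ->
        m (fun h => a * u h + v h) = a * m u + m v,
      forall u : G -> R,
        bounded_function u -> (forall h, 0 <= u h) -> 0 <= m u,
      m (fun=> 1) = 1
    & forall (g : G) (u : G -> R),
        bounded_function u -> m (fun h => u (g * h)%g) = m u].

Definition amenable (R : realType) (G : groupType) : Prop :=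
  exists m : (G -> R) -> R, left_invariant_mean m.

Definition sqr_esum (R : realType) (G : choiceType) (x : G -> R[i]) : \bar R :=
  \esum_(g in [set: G]) (normc (x g) ^+ 2)%:E.

Definition square_summable (R : realType) (G : choiceType) :
    {pred (G -> R[i])} :=
  [pred x | `[< (sqr_esum x < +oo)%E >]].

Section l2_space.
Variables (R : realType) (G : choiceType).

Lemma square_summableP (x : G -> R[i]) :
  reflect (sqr_esum x < +oo)%E (x \in @square_summable R G).
Proof. exact: asboolP. Qed.

Lemma square_summable_submod : submod_closed (@square_summable R G).
Proof.
have n0 (z : R[i]) : 0 <= normc z by case: z => ? ?; exact: sqrtr_ge0.
have pos (c : R) (z : R[i]) : 0 <= c -> (0 <= (c * normc z ^+ 2)%:E)%E.
  by move=> c0; rewrite lee_fin mulr_ge0 ?sqr_ge0.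
have scale (c : R) (z : G -> R[i]) : 0 <= c -> (sqr_esum z < +oo)%E ->
    (\esum_(g in [set: G]) (c * normc (z g) ^+ 2)%:E < +oo)%E.
  move=> c0 fz; apply: (@le_lt_trans _ _ (c%:E * sqr_esum z)%E); last first.
    by rewrite lte_mul_pinfty ?lee_fin.
  apply: ge_ereal_sup => _ [F [finF FT] <-].
  under eq_fsbigr do rewrite EFinM.
  rewrite -ge0_mule_fsumr; last by move=> g; rewrite lee_fin sqr_ge0.
  by apply: lee_wpmul2l; [rewrite lee_fin|apply: esum_ge; exists F].
split=> [|a x y].
  apply/square_summableP; rewrite /sqr_esum esum1 ?ltry// => g _.
  by rewrite [X in normc X](_ : _ = 0%C)// normc0 expr0n.
move=> /square_summableP fx /square_summableP fy; apply/square_summableP.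
apply: (@le_lt_trans _ _ (\esum_(g in [set: G])
    ((2 * normc a ^+ 2 * normc (x g) ^+ 2)%:E
     + (2 * normc (y g) ^+ 2)%:E))%E); last first.
  rewrite esumD; [|by move=> g _; apply: pos; rewrite ?mulr_ge0 ?sqr_ge0..].
  by rewrite lte_add_pinfty// scale// mulr_ge0 ?sqr_ge0.
apply: le_esum => g _; rewrite -EFinD lee_fin.
rewrite -[(a *: x + y) g]/(a * x g + y g).
have := le_normcD (a * x g) (y g); rewrite normcM.
set A := normc a; set X := normc (x g); set Y := normc (y g) => le.
have AX0 : 0 <= A * X by rewrite mulr_ge0 ?n0.
apply: (@le_trans _ _ ((A * X + Y) ^+ 2)).
  by rewrite ler_sqr ?nnegrE ?addr_ge0 ?n0.
rewrite -subr_ge0 (_ : _ - _ = (A * X - Y) ^+ 2) ?sqr_ge0//; ring.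
Qed.

HB.instance Definition _ :=
  GRing.isSubmodClosed.Build R[i] (G -> R[i]) (@square_summable R G)
    square_summable_submod.

Record l2 := L2 { l2_val :> G -> R[i]; _ : l2_val \in @square_summable R G }.

HB.instance Definition _ := [isSub for l2_val].
HB.instance Definition _ := [Choice of l2 by <:].
HB.instance Definition _ := [SubChoice_isSubLmodule of l2 by <:].

Definition l2_norm (x : l2) : R := Num.sqrt (fine (sqr_esum x)).

Definition bounded_operator (T : l2 -> l2) : Prop :=
  exists M : R, forall x, l2_norm (T x) <= M * l2_norm x.

End l2_space.

Section reduced_group_Cstar_algebra.
Variables (R : realType) (G : groupType).

Lemma translate_square_summable (g : G) (x : l2 R G) :
  (fun h => x (g^-1 * h)%g) \in @square_summable R G.
Proof.
case: x => x xP /=; apply/square_summableP.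
suff -> : sqr_esum (fun h => x (g^-1 * h)%g) = sqr_esum x.
  exact/square_summableP.
rewrite [RHS](@reindex_esum _ _ _ [set: G] _ (fun h => (g^-1 * h)%g))//.
split=> // [h k _ _|h _]; first exact: mulgI.
by exists (g * h)%g => //; rewrite mulKg.
Qed.

Definition left_translation (g : G) (x : l2 R G) : l2 R G :=
  L2 (translate_square_summable g x).

(* The group ring C[G] consists of the finitely supported functions on G. *)
Definition left_regular (f : {fsfun G -> R[i] with 0}) (x : l2 R G) : l2 R G :=
  \sum_(g <- finsupp f) f g *: left_translation g x.

(* The closure, for the operator norm on B(l^2(G)), of the image of C[G] under
   the left regular representation. *)
Definition reduced_group_Cstar : set {linear l2 R G -> l2 R G} :=
  [set T : {linear l2 R G -> l2 R G} | bounded_operator T /\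
    forall e : R, 0 < e -> exists f : {fsfun G -> R[i] with 0},
      forall x, l2_norm (T x - left_regular f x) <= e * l2_norm x].

Definition Kadison_Kaplansky : Prop :=
  torsion_free G /\
  forall T : {linear l2 R G -> l2 R G}, reduced_group_Cstar T ->
    T \o T =1 T -> T =1 (fun=> 0) \/ T =1 id.

End reduced_group_Cstar_algebra.

(* Main.v *)
Require Import Defs.
From HB Require Import structures.
From mathcomp Require Import all_boot all_order all_algebra.
From mathcomp Require Import finmap complex ring lra.
From mathcomp Require Import all_classical all_reals.
From mathcomp Require Import ereal esum topology normedtype trigo.

Set Implicit Arguments.
Unset Strict Implicit.
Unset Printing Implicit Defensive.

Import Order.TTheory GRing.Theory Num.Theory.
Import numFieldNormedType.Exports.
Import Normc.

Local Open Scope classical_set_scope.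
Local Open Scope ring_scope.

(* For a character [chi] of N, the functions [x] on G with [x (i n y) = chi n x y] form a copy of
   l^2(H) on which C[G] acts. Multiplication by almost invariant vectors of N and H shows that the
   norms on these fibres are bounded by the norm on l^2(G) and depend continuously on [chi]. An
   idempotent of C*_r(G) thus induces an idempotent on every fibre, and as a nonzero idempotent has
   norm at least 1, the set of characters at which it vanishes is open and closed. At [chi = 1] it
   is an idempotent of C*_r(H), hence 0 or the identity; after replacing [T] by [1 - T] it is 0
   there, and so it is 0 along all paths [t |-> exp (i t phi)] with [phi] a homomorphism from N to
   the reals. Since N is torsion-free, such [phi] separate its points, so that the fibres at the
   characters [exp (i phi)] determine the coefficients of an element of C[G]; this gives [T = 0]. *)

(** The operators on the fibres are never constructed: [T] is seen only through formal sums that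
    approximate it on l^2(G), and each claim about a fibre is a norm estimate for such sums. The
    obstacle is to carry an estimate from l^2(G) to a fibre, because for infinite N a nonzero
    equivariant function is not square summable. Almost invariant weights cut it off at small cost:
    on H they come from the invariant mean, on N from commutativity. The weight on H moreover has
    finite support, so only finitely many values of the cocycle of the extension matter. Hence
    replacing [chi] by [chi psi] changes the norm of a given formal sum little as soon as [psi] is
    close to 1 on a finite set, and how close does not depend on [chi]. This uniformity lets
    finitely many steps cover a whole path. The paths stand in for the connectedness of the dual of
    a torsion-free Abelian group. Each passage to a fibre loses an arbitrarily small amount, which
    explains the slack in the constants. *)

(** * Square sums with values in the extended reals, and Minkowski's inequality *)

Section sqr_esum_theory.
Variables (R : realType).
Implicit Types T : choiceType.

Lemma normc_ge0 (z : R[i]) : 0 <= normc z.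
Proof. by case: z => ? ?; exact: sqrtr_ge0. Qed.

Lemma esumZl T (c : R) (a : T -> \bar R) : 0 <= c -> (forall t, (0 <= a t)%E) ->
  (\esum_(t in [set: T]) (c%:E * a t) = c%:E * \esum_(t in [set: T]) a t)%E.
Proof.
move=> c0 a0.
have half (d : R) (b : T -> \bar R) : 0 <= d -> (forall t, (0 <= b t)%E) ->
    (\esum_(t in [set: T]) (d%:E * b t) <= d%:E * \esum_(t in [set: T]) b t)%E.
  move=> d0 b0; apply: ge_ereal_sup => _ [F [finF FT] <-].
  rewrite -ge0_mule_fsumr //.
  by apply: lee_wpmul2l; [rewrite lee_fin|apply: esum_ge; exists F].
have [->|cn0] := eqVneq c 0.
  by rewrite mul0e esum1 // => t _; rewrite mul0e.
apply/eqP; rewrite eq_le half //=.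
have cV : 0 <= c^-1 by rewrite invr_ge0.
have := half c^-1 (fun t => c%:E * a t)%E cV.
have -> : \esum_(t in [set: T]) (c^-1%:E * (c%:E * a t))%E = \esum_(t in [set: T]) a t.
  by apply: eq_esum => t _; rewrite muleA -EFinM mulVf // mul1e.
move=> le; have := lee_wpmul2l (x := c%:E) _ (le _).
rewrite lee_fin => /(_ c0) le'; apply: (le_trans (le' _)) => [t|].
  by rewrite mule_ge0 // lee_fin.
by rewrite muleA -EFinM divff // mul1e.
Qed.

Lemma sqr_esum_ge0 T (x : T -> R[i]) : (0 <= sqr_esum x)%E.
Proof. by apply: esum_ge0 => t _; rewrite lee_fin sqr_ge0. Qed.

Lemma le_sqr_esum T (x y : T -> R[i]) :
  (forall t, normc (x t) <= normc (y t)) -> (sqr_esum x <= sqr_esum y)%E.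
Proof.
move=> xy; apply: le_esum => t _.
by rewrite lee_fin ler_sqr ?nnegrE ?normc_ge0.
Qed.

Lemma eq_sqr_esum T (x y : T -> R[i]) :
  (forall t, normc (x t) = normc (y t)) -> sqr_esum x = sqr_esum y.
Proof. by move=> xy; apply: eq_esum => t _; rewrite xy. Qed.

Lemma esum_pair T T' (a : T * T' -> \bar R) : (forall x, (0 <= a x)%E) ->
  (\esum_(x in [set: T * T']) a x =
   \esum_(t in [set: T]) \esum_(s in [set: T']) a (t, s))%E.
Proof.
move=> a0; rewrite esum_esum // (_ : [set: T * T'] = [set: T] `*`` (fun=> [set: T'])).
  by apply: eq_esum => -[].
by apply/seteqP; split.
Qed.

Lemma esum_ge_term T (a : T -> \bar R) t : (forall t, (0 <= a t)%E) ->
  (a t <= \esum_(s in [set: T]) a s)%E.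
Proof.
move=> a0; apply: esum_ge; exists [set t]; first by split => //; exact: finite_set1.
by rewrite fsbig_set1.
Qed.

Lemma esum_delta T (t : T) : \esum_(s in [set: T]) ((t == s)%:R : R)%:E = 1%E.
Proof.
rewrite -(@esum_set1 R T t (fun=> 1%E)) // [RHS]esum_mkcond.
apply: eq_esum => s _; case: (eqVneq t s) => [->|ts].
  by rewrite ifT // in_setE.
by rewrite ifF //; apply/negP; rewrite in_setE /= => st; rewrite st eqxx in ts.
Qed.

Lemma sqr_esum_ge T (x : T -> R[i]) t : ((normc (x t) ^+ 2)%:E <= sqr_esum x)%E.
Proof.
by apply: (@esum_ge_term _ (fun t => (normc (x t) ^+ 2)%:E)) => s; rewrite lee_fin sqr_ge0.
Qed.

Lemma sqr_esumZ T (c : R[i]) (x : T -> R[i]) :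
  sqr_esum (fun t => c * x t) = ((normc c ^+ 2)%:E * sqr_esum x)%E.
Proof.
rewrite /sqr_esum -esumZl ?sqr_ge0 // => [|t]; last by rewrite lee_fin sqr_ge0.
by apply: eq_esum => t _; rewrite normcM exprMn EFinM.
Qed.

Lemma sqr_esumN T (x : T -> R[i]) : sqr_esum (fun t => - x t) = sqr_esum x.
Proof. by apply: eq_sqr_esum => t; rewrite normcN. Qed.

Lemma sqr_esum_reindex T T' (e : T' -> T) (x : T -> R[i]) :
  bijective e -> sqr_esum x = sqr_esum (fun t => x (e t)).
Proof.
move=> bij; rewrite /sqr_esum (@reindex_esum _ _ _ [set: T'] _ e) //.
split => // [s t _ _|t _]; first exact: bij_inj.
by case: bij => f ef fe; exists (f t).
Qed.

Lemma sqr_esum_eq0 T (x : T -> R[i]) : (sqr_esum x <= 0)%E -> forall t, x t = 0.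
Proof.
move=> x0 t; apply: eq0_normc; apply/eqP; rewrite -sqrf_eq0 eq_le sqr_ge0 andbT.
by rewrite -lee_fin (le_trans (sqr_esum_ge x t)).
Qed.

Lemma sqr_esum0 T : @sqr_esum R T (fun=> 0) = 0%E.
Proof. by rewrite /sqr_esum esum1 // => t _; rewrite normc0 expr0n. Qed.

(* With weight [c = B / A], Minkowski follows from the pointwise bound
   [(a + b)^2 <= (1 + c) a^2 + (1 + c^-1) b^2]. *)
Lemma sqr_esumD T (x y : T -> R[i]) (A B : R) : 0 <= A -> 0 <= B ->
  (sqr_esum x <= (A ^+ 2)%:E)%E -> (sqr_esum y <= (B ^+ 2)%:E)%E ->
  (sqr_esum (fun t => (x t + y t)%R) <= ((A + B) ^+ 2)%:E)%E.
Proof.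
move=> A0 B0 xA yB.
have [A00|An0] := eqVneq A 0.
  have x0 : forall t, x t = 0 by apply: sqr_esum_eq0; rewrite (le_trans xA) ?A00 ?expr0n.
  by rewrite A00 add0r (le_trans _ yB) // le_sqr_esum // => t; rewrite x0 add0r.
have [B00|Bn0] := eqVneq B 0.
  have y0 : forall t, y t = 0 by apply: sqr_esum_eq0; rewrite (le_trans yB) ?B00 ?expr0n.
  by rewrite B00 addr0 (le_trans _ xA) // le_sqr_esum // => t; rewrite y0 addr0.
have Ap : 0 < A by rewrite lt_neqAle eq_sym An0.
have Bp : 0 < B by rewrite lt_neqAle eq_sym Bn0.
pose c := B / A; have cp : 0 < c by rewrite divr_gt0.
have pos (d : R) (z : R[i]) : 0 <= d -> (0 <= d%:E * (normc z ^+ 2)%:E)%E.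
  by move=> d0; rewrite -EFinM lee_fin mulr_ge0 ?sqr_ge0.
have c1 : 0 <= 1 + c by rewrite addr_ge0 // ltW.
have c2 : 0 <= 1 + c^-1 by rewrite addr_ge0 // invr_ge0 ltW.
apply: (@le_trans _ _ (\esum_(t in [set: T])
   ((1 + c)%:E * (normc (x t) ^+ 2)%:E + (1 + c^-1)%:E * (normc (y t) ^+ 2)%:E))%E).
  apply: le_esum => t _; rewrite -!EFinM -EFinD lee_fin.
  have := le_normcD (x t) (y t).
  move: (normc_ge0 (x t)) (normc_ge0 (y t)) (normc_ge0 (x t + y t)).
  move: (normc _) (normc _) (normc _) => d b a a0 b0 d0 dab.
  apply: (@le_trans _ _ ((a + b) ^+ 2)); first by rewrite ler_sqr ?nnegrE ?addr_ge0.
  rewrite -subr_ge0 (_ : _ - _ = c^-1 * (c * a - b) ^+ 2); last by field; rewrite gt_eqF.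
  by rewrite mulr_ge0 ?sqr_ge0 // invr_ge0 ltW.
rewrite esumD; [|by move=> t _; apply: pos; assumption|by move=> t _; apply: pos; assumption].
rewrite !esumZl //; [|by move=> t; rewrite lee_fin sqr_ge0..].
apply: (@le_trans _ _ ((1 + c)%:E * (A ^+ 2)%:E + (1 + c^-1)%:E * (B ^+ 2)%:E)%E).
  by apply: leeD; apply: lee_wpmul2l; rewrite ?lee_fin.
rewrite -!EFinM -EFinD lee_fin le_eqVlt; apply/orP; left; apply/eqP.
by rewrite /c; field; rewrite An0.
Qed.

Lemma sqr_esumB T (x y : T -> R[i]) (A B : R) : 0 <= A -> 0 <= B ->
  (sqr_esum x <= (A ^+ 2)%:E)%E -> (sqr_esum y <= (B ^+ 2)%:E)%E ->
  (sqr_esum (fun t => (x t - y t)%R) <= ((A + B) ^+ 2)%:E)%E.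
Proof. by move=> A0 B0 xA yB; apply: sqr_esumD => //; rewrite sqr_esumN. Qed.

Lemma sqr_esum_sum T (I : eqType) (s : seq I) (x : I -> T -> R[i]) (A : I -> R) :
  (forall i, 0 <= A i) ->
  (forall i, i \in s -> (sqr_esum (x i) <= (A i ^+ 2)%:E)%E) ->
  (sqr_esum (fun t => (\sum_(i <- s) x i t)%R) <= ((\sum_(i <- s) A i) ^+ 2)%:E)%E.
Proof.
move=> A0; elim: s => [_|i s IH xA].
  rewrite big_nil expr0n (eq_sqr_esum (y := fun=> 0)) ?sqr_esum0 // => t.
  by rewrite big_nil.
rewrite big_cons (eq_sqr_esum (y := fun t => x i t + \sum_(i <- s) x i t)) => [|t]; last first.
  by rewrite big_cons.
apply: sqr_esumD; rewrite ?sumr_ge0 ?xA ?mem_head ?IH // => k ks.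
by rewrite xA // inE ks orbT.
Qed.

(* Absorbs a possibly infinite norm: for [sqr_esum x = +oo] there is nothing to prove. *)
Lemma sqr_esum_scaled T T' (x : T -> R[i]) (y : T' -> R[i]) (b : R) : 0 < b ->
  (forall A : R, 0 <= A -> (sqr_esum x <= (A ^+ 2)%:E)%E ->
     (sqr_esum y <= ((b * A) ^+ 2)%:E)%E) ->
  (sqr_esum y <= (b ^+ 2)%:E * sqr_esum x)%E.
Proof.
move=> b0 le; have := sqr_esum_ge0 x.
case xE : (sqr_esum x) => [r| |] // r0; last first.
  by rewrite gt0_muley ?leey // lte_fin exprn_gt0.
rewrite lee_fin in r0; have := le (Num.sqrt r); rewrite sqrtr_ge0 => /(_ isT).
by rewrite sqr_sqrtr // xE exprMn sqr_sqrtr // EFinM; apply.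
Qed.

Lemma sqr_esum_pair T T' (x : T * T' -> R[i]) :
  sqr_esum x = \esum_(t in [set: T]) sqr_esum (fun s => x (t, s)).
Proof. by rewrite /sqr_esum esum_pair // => t; rewrite lee_fin sqr_ge0. Qed.

(** Tonelli, with [z] constant along the second coordinate. Asking for the bound only where [z] is
    nonzero is what later makes the finite support of a cutoff useful. *)
Lemma sqr_esum_mul_pair T T' (x : T * T' -> R[i]) (z : T -> R[i]) (e : R) : 0 <= e ->
  (forall t, z t != 0 -> (sqr_esum (fun s => x (t, s)) <= e%:E)%E) ->
  (sqr_esum (fun ts => (x ts * z ts.1)%R) <= e%:E * sqr_esum z)%E.
Proof.
move=> e0 xe; rewrite sqr_esum_pair -esumZl //; last by move=> t; rewrite lee_fin sqr_ge0.
apply: le_esum => t _ /=.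
have [z0|zn0] := eqVneq (z t) 0.
  rewrite (@eq_sqr_esum _ _ (fun=> 0)) ?sqr_esum0 => [|s]; last by rewrite z0 mulr0.
  by rewrite mule_ge0 // lee_fin sqr_ge0.
rewrite (@eq_sqr_esum _ _ (fun s => z t * x (t, s))) => [|s]; last by rewrite mulrC.
by rewrite sqr_esumZ muleC; apply: lee_wpmul2r; rewrite ?lee_fin ?sqr_ge0 ?xe.
Qed.

Lemma sqr_esum_mul_pair1 T T' (x : T * T' -> R[i]) (z : T -> R[i]) :
  (forall t, sqr_esum (fun s => x (t, s)) = 1%E) ->
  sqr_esum (fun ts => x ts * z ts.1) = sqr_esum z.
Proof.
move=> x1; rewrite sqr_esum_pair; apply: eq_esum => t _ /=.
rewrite (@eq_sqr_esum _ _ (fun s => z t * x (t, s))) => [|s]; last by rewrite mulrC.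
by rewrite sqr_esumZ x1 mule1.
Qed.

End sqr_esum_theory.

(** * Hahn-Banach theorem and separation from a cone *)

Section hahn_banach.
Variables (R : realType) (V : lmodType R).

(** Inequalities pass to infima, and homogeneity for [a^-1] recovers the equality. *)
Definition sublinear (p : V -> R) : Prop :=
  (forall x y, p (x + y) <= p x + p y) /\
  (forall a x, 0 < a -> p (a *: x) <= a * p x).

Lemma sublinear_ge0 p : sublinear p -> 0 <= p 0.
Proof. by move=> [+ _] => /(_ 0 0); rewrite addr0; lra. Qed.

Lemma sublinear_geN p x : sublinear p -> - p (- x) <= p x.
Proof.
move=> sp; have := sublinear_ge0 sp; case: sp => /(_ x (- x)) + _.
by rewrite subrr; lra.
Qed.

Lemma sublinearZ p a x : sublinear p -> 0 < a -> p (a *: x) = a * p x.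
Proof.
move=> [_ sp] a0; apply/eqP; rewrite eq_le sp //=.
have aV : 0 < a^-1 by rewrite invr_gt0.
have := sp a^-1 (a *: x) aV; rewrite scalerA mulVf ?gt_eqF // scale1r => le.
by rewrite -ler_pdivlMl.
Qed.

Lemma sublinear_inf (E : V -> set R) :
  (forall x, has_inf (E x)) ->
  (forall x y a b, E x a -> E y b -> exists2 c, E (x + y) c & c <= a + b) ->
  (forall t x a, 0 < t -> E x a -> exists2 c, E (t *: x) c & c <= t * a) ->
  sublinear (fun x => inf (E x)).
Proof.
move=> infE addE scaleE; split=> [x y|t x t0].
  apply/ler_addgt0Pr => e e0; have e2 : 0 < e / 2 by rewrite divr_gt0.
  have [a Ea lta] := inf_adherent e2 (infE x).
  have [b Eb ltb] := inf_adherent e2 (infE y).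
  have [c Ec lec] := addE _ _ _ _ Ea Eb.
  by have := ge_inf (infE (x + y)).2 Ec; lra.
apply/ler_addgt0Pr => e e0; have e2 : 0 < e / t by rewrite divr_gt0.
have [a Ea lta] := inf_adherent e2 (infE x).
have [c Ec lec] := scaleE _ _ _ t0 Ea.
have le1 := ge_inf (infE (t *: x)).2 Ec.
apply: (le_trans le1); apply: (le_trans lec).
rewrite (_ : t * _ + e = t * (inf (E x) + e / t)).
  by rewrite ler_pM2l // ltW.
by rewrite mulrDr mulrCA divff ?gt_eqF // mulr1.
Qed.

(* A minimal sublinear functional [q] is linear: for fixed [y] it cannot exceed
   [x |-> inf_(t >= 0) (q (x + t y) - t q y)], which gives [q x + q y <= q (x + y)]. *)
Lemma minimal_sublinear_additive q : sublinear q ->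
  (forall q', sublinear q' -> (forall x, q' x <= q x) -> forall x, q x <= q' x) ->
  forall x y, q (x + y) = q x + q y.
Proof.
move=> sq minq x y; apply/eqP; rewrite eq_le sq.1 /=.
pose E (z : V) := [set q (z + t *: y) - t * q y | t in [set t | 0 <= t]].
have Elb z : lbound (E z) (- q (- z)).
  move=> _ [t /= t0 <-]; have := sq.1 (z + t *: y) (- z).
  rewrite addrAC subrr add0r.
  (* Homogeneity covers positive factors only, so [t = 0] leaves the term [q 0], of which just
     nonnegativity has been shown. *)
  have -> : q (t *: y) = t * q y + (if t == 0 then q 0 else 0).
    case: eqVneq => [->|tn0]; first by rewrite scale0r mul0r add0r.
    by rewrite addr0 sublinearZ // lt_neqAle eq_sym tn0.
  by case: ifP => _; have := sublinear_ge0 sq; lra.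
have Einf z : has_inf (E z).
  split; last by exists (- q (- z)); exact: Elb.
  by exists (q (z + 0 *: y) - 0 * q y); exists 0 => /=.
have sE : sublinear (fun z => inf (E z)).
  apply: sublinear_inf => //.
    move=> a b _ _ [t /= t0 <-] [s /= s0 <-].
    exists (q (a + b + (t + s) *: y) - (t + s) * q y).
      by exists (t + s) => //=; rewrite addr_ge0.
    by have := sq.1 (a + t *: y) (b + s *: y); rewrite addrACA -scalerDl; lra.
  move=> s a _ s0 [t /= t0 <-].
  exists (q (s *: a + (s * t) *: y) - (s * t) * q y).
    by exists (s * t) => //=; rewrite mulr_ge0 // ltW.
  by have := sq.2 s (a + t *: y) s0; rewrite scalerDr scalerA; lra.
have Eq z : inf (E z) <= q z.
  apply: ge_inf; first exact: (Einf z).2.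
  by exists 0 => //=; rewrite scale0r addr0 mul0r subr0.
have := minq _ sE Eq x.
have : inf (E x) <= q (x + y) - q y.
  apply: ge_inf; first exact: (Einf x).2.
  by exists 1 => //=; rewrite ?ler01 // scale1r mul1r.
lra.
Qed.

(** Instead of extending a functional from a subspace, [p] itself is lowered to a minimal sublinear
    functional, by Zorn's lemma for the reversed order. A chain has its pointwise infimum as lower
    bound, which is finite because all members stay above [- p (- x)]. *)
Theorem hahn_banach (p : V -> R) : sublinear p ->
  exists f : V -> R, [/\ forall x y, f (x + y) = f x + f y,
    forall a x, f (a *: x) = a * f x & forall x, f x <= p x].
Proof.
move=> sp; pose T := {q : V -> R | sublinear q /\ forall x, q x <= p x}.
pose t0 : T := exist _ p (conj sp (fun x => lexx (p x))).
pose r : rel T := fun q q' => `[< forall x, sval q' x <= sval q x >].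
have [|||[q [sq qp]] qmin] := @ZL_preorder T t0 r.
- by move=> q; apply/asboolP.
- move=> q1 q2 q3 /asboolP h1 /asboolP h2; apply/asboolP => x.
  exact: le_trans (h1 x).
- move=> A totA; have [A0|/set0P[q0 Aq0]] := eqVneq A set0.
    by exists t0 => s; rewrite A0.
  pose E (x : V) := [set sval q x | q in A].
  have Einf x : has_inf (E x).
    split; first by exists (sval q0 x); exists q0.
    exists (- p (- x)) => _ [[q [sq qp]] Aq <-] /=.
    by rewrite (le_trans _ (sublinear_geN x sq)) // lerN2.
  have sE : sublinear (fun x => inf (E x)).
    apply: sublinear_inf => //.
      move=> x y _ _ [q1 A1 <-] [q2 A2 <-].
      have [/asboolP h|/asboolP h] := totA _ _ A1 A2.
        exists (sval q2 (x + y)); first by exists q2.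
        by have := (svalP q2).1.1 x y; have := h x; lra.
      exists (sval q1 (x + y)); first by exists q1.
      by have := (svalP q1).1.1 x y; have := h y; lra.
    move=> t x _ t_gt0 [q Aq <-]; exists (sval q (t *: x)); first by exists q.
    exact: (svalP q).1.2.
  have lE q : A q -> forall x, inf (E x) <= sval q x.
    by move=> Aq x; apply: ge_inf; [exact: (Einf x).2|exists q].
  have Ep x : inf (E x) <= p x by apply: le_trans (lE _ Aq0 x) _; exact: (svalP q0).2.
  pose t1 : T := exist (fun q => sublinear q /\ forall x, q x <= p x) _ (conj sE Ep).
  exists t1 => q Aq; apply/asboolP; exact: lE.
have addq : forall x y, q (x + y) = q x + q y.
  apply: minimal_sublinear_additive => // q' sq' le x.
  have lep z : q' z <= p z by apply: le_trans (qp z).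
  pose t1 : T := exist (fun q => sublinear q /\ forall x, q x <= p x) _ (conj sq' lep).
  by have /asboolP := qmin t1 (asboolT le); apply.
have q0 : q 0 = 0 by have := addq 0 0; rewrite addr0; lra.
have qN x : q (- x) = - q x by have := addq x (- x); rewrite subrr q0; lra.
exists q; split => // a x; have [a0|a0|->] := ltgtP a 0.
- rewrite -[a in LHS]opprK scaleNr qN sublinearZ // ?oppr_gt0 //; ring.
- exact: sublinearZ.
- by rewrite scale0r mul0r.
Qed.

(* The functional is obtained by extending from [v = 0] the sublinear
   [v |-> inf (p (v + \sum c K) - e \sum c)] over nonnegative combinations of the [K i]. *)
Lemma separate_cone (I : Type) (p : V -> R) (K : I -> V) (e : R) : sublinear p ->
  (forall l : seq (R * I), all (fun ci => 0 <= ci.1) l ->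
     e * (\sum_(ci <- l) ci.1) <= p (\sum_(ci <- l) ci.1 *: K ci.2)) ->
  exists f : V -> R, [/\ forall x y, f (x + y) = f x + f y,
    forall a x, f (a *: x) = a * f x, forall x, f x <= p x & forall i, e <= f (K i)].
Proof.
move=> sp cone.
pose val (v : V) (l : seq (R * I)) :=
  p (v + \sum_(ci <- l) ci.1 *: K ci.2) - e * (\sum_(ci <- l) ci.1).
pose E (v : V) := [set val v l | l in [set l | all (fun ci => 0 <= ci.1) l]].
have Einf v : has_inf (E v).
  split; first by exists (val v [::]); exists [::].
  exists (- p (- v)) => _ [l /= l0 <-]; rewrite /val.
  have := sp.1 (v + \sum_(ci <- l) ci.1 *: K ci.2) (- v).
  by rewrite addrAC subrr add0r; have := cone l l0; lra.
have sE : sublinear (fun v => inf (E v)).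
  apply: sublinear_inf => //.
    move=> v w _ _ [l1 /= p1 <-] [l2 /= p2 <-].
    exists (val (v + w) (l1 ++ l2)).
      by exists (l1 ++ l2) => //=; rewrite all_cat p1 p2.
    rewrite /val !big_cat /= addrACA.
    have := sp.1 (v + \sum_(ci <- l1) ci.1 *: K ci.2) (w + \sum_(ci <- l2) ci.1 *: K ci.2).
    by rewrite mulrDr; lra.
  move=> t v _ t0 [l /= l0 <-]; exists (val (t *: v) [seq (t * ci.1, ci.2) | ci <- l]).
    exists [seq (t * ci.1, ci.2) | ci <- l] => //=; rewrite all_map.
    by apply: sub_all l0 => ci /= c0; rewrite mulr_ge0 // ltW.
  rewrite /val !big_map /=.
  under eq_bigr do rewrite -scalerA.
  rewrite -scaler_sumr -mulr_sumr -scalerDr.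
  by have := sp.2 t (v + \sum_(ci <- l) ci.1 *: K ci.2) t0; lra.
have [f [fD fZ fE]] := hahn_banach sE.
have le l v : all (fun ci => 0 <= ci.1) l -> f v <= val v l.
  by move=> l0; apply: le_trans (fE v) _; apply: ge_inf; [exact: (Einf v).2|exists l].
exists f; split => // [x|i].
  by have := le [::] x isT; rewrite /val !big_nil addr0 mulr0 subr0.
(* Evaluating at [- K i] with the combination [1 *: K i] gives [f (- K i) <= p 0 - e], so [p 0] has
   to be at most 0. *)
have p0 : p 0 <= 0 by have := sp.2 2^-1 0 ltac:(by rewrite invr_gt0); rewrite scaler0; lra.
have := le [:: (1, i)] (- K i).
rewrite /= ler01 /val !big_seq1 /= scale1r addNr mulr1 => /(_ isT).
by rewrite -scaleN1r fZ; lra.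
Qed.

End hahn_banach.

(** * The real space l^1 and its point masses *)

Section l1_space.
Variables (R : realType) (X : choiceType).

Definition abs_summable : {pred X -> R^o} :=
  [pred v | `[< (\esum_(x in [set: X]) `|v x|%:E < +oo)%E >]].

Lemma abs_summable_le (a : R) (u v : X -> R) :
  (\esum_(x in [set: X]) `|a * u x + v x|%:E <=
   `|a|%:E * (\esum_(x in [set: X]) `|u x|%:E) + \esum_(x in [set: X]) `|v x|%:E)%E.
Proof.
rewrite -esumZl // -esumD //.
by apply: le_esum => x _; rewrite -EFinM -EFinD lee_fin -normrM ler_normD.
Qed.

Lemma abs_summable_submod : submod_closed abs_summable.
Proof.
split=> [|a u v /asboolP fu /asboolP fv]; apply/asboolP.
  by rewrite esum1 ?ltry // => x _; rewrite normr0.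
apply: le_lt_trans (abs_summable_le a u v) _.
by rewrite lte_add_pinfty // lte_mul_pinfty ?lee_fin.
Qed.

HB.instance Definition _ :=
  GRing.isSubmodClosed.Build R (X -> R^o) abs_summable abs_summable_submod.

Record l1 := L1 { l1_val :> X -> R^o; _ : l1_val \in abs_summable }.

HB.instance Definition _ := [isSub for l1_val].
HB.instance Definition _ := [Choice of l1 by <:].
HB.instance Definition _ := [SubChoice_isSubLmodule of l1 by <:].

Definition l1_norm (v : l1) : R := fine (\esum_(x in [set: X]) `|v x|%:E).

Lemma l1_normE (v : l1) : (l1_norm v)%:E = \esum_(x in [set: X]) `|v x|%:E.
Proof.
case: v => v vP; rewrite /l1_norm /= fineK //; move/asboolP: vP => vP.
by rewrite fin_numElt vP (lt_le_trans (ltNyr 0)) // esum_ge0.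
Qed.

Lemma l1_norm_sublinear : sublinear l1_norm.
Proof.
split=> [u v|a u a0]; rewrite -lee_fin; last first.
  rewrite EFinM !l1_normE -esumZl ?(ltW a0) //; apply: le_esum => x _.
  by rewrite -EFinM lee_fin -[(a *: u) x]/(a * u x) normrM gtr0_norm.
rewrite EFinD !l1_normE -esumD //; apply: le_esum => x _.
by rewrite -EFinD lee_fin; exact: ler_normD.
Qed.

Lemma delta_abs_summable (y : X) : (fun x => (y == x)%:R : R^o) \in abs_summable.
Proof.
apply/asboolP; rewrite (eq_esum (b := fun x => ((y == x)%:R : R)%:E)) => [|x _].
  by rewrite esum_delta ltry.
by rewrite ger0_norm.
Qed.

Definition delta (y : X) : l1 := L1 (delta_abs_summable y).

Lemma l1_norm_delta y : l1_norm (delta y) = 1.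
Proof.
apply: EFin_inj; rewrite l1_normE -(esum_delta R y).
by apply: eq_esum => x _; rewrite ger0_norm.
Qed.

Lemma l1_sum I (s : seq I) (F : I -> l1) x : (\sum_(i <- s) F i) x = \sum_(i <- s) F i x.
Proof. by elim: s => [|i s IH]; rewrite ?big_nil // !big_cons -IH. Qed.

End l1_space.

(** * Almost invariant densities on amenable and on Abelian groups *)

Section invariant_densities.
Variable R : realType.

(** Reiter's condition for the finite set [S]. *)
Definition almost_invariant (G : groupType) (S : seq G) (e : R) (phi : G -> R) : Prop :=
  [/\ forall h, 0 <= phi h, \esum_(h in [set: G]) (phi h)%:E = 1%E &
    forall s, s \in S -> (\esum_(h in [set: G]) `|phi (s^-1 * h)%g - phi h|%:E <= e%:E)%E].

Definition combination (X : choiceType) (l : seq (R * X)) (x : X) : R :=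
  \sum_(ci <- l) ci.1 * (ci.2 == x)%:R.

Lemma combination_ge0 (X : choiceType) (l : seq (R * X)) x :
  all (fun ci => 0 <= ci.1) l -> 0 <= combination l x.
Proof.
move=> /allP l0; rewrite /combination big_seq sumr_ge0 // => ci cil.
by rewrite mulr_ge0 ?l0.
Qed.

Lemma esum_combination (X : choiceType) (l : seq (R * X)) :
  all (fun ci => 0 <= ci.1) l ->
  \esum_(x in [set: X]) (combination l x)%:E = (\sum_(ci <- l) ci.1)%:E.
Proof.
elim: l => [_|ci l IH /= /andP[c0 l0]].
  by rewrite big_nil esum1 // => x _; rewrite /combination big_nil.
rewrite big_cons EFinD -IH // -[ci.1%:E]mule1 -(esum_delta R ci.2).
rewrite -(esumZl c0) => [|x]; last by rewrite lee_fin.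
rewrite -(@esumD _ _ [set: X]) => [|x _|x _].
- by apply: eq_esum => x _; rewrite /combination big_cons EFinD EFinM.
- by rewrite mule_ge0 // lee_fin.
- by rewrite lee_fin combination_ge0.
Qed.

(** The first coordinate labels the translating element, so that the displacements by all of [S]
    form one vector and a single functional separates them simultaneously (the product trick of Day
    and Namioka). *)
Definition displacement (G : groupType) (S : seq G) (h : G) : l1 R (G * G)%type :=
  \sum_(s <- S) (delta R (s, (s * h)%g) - delta R (s, h)).

Lemma displacement_combination (G : groupType) (S : seq G) (l : seq (R * G)) s h :
  uniq S -> s \in S ->
  (\sum_(ci <- l) ci.1 *: displacement S ci.2) (s, h) =
  combination l (s^-1 * h)%g - combination l h.
Proof.
move=> uS sS; rewrite l1_sum /combination -sumrB; apply: eq_bigr => -[c k] _ /=.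
rewrite -[LHS]/(c * displacement S k (s, h)) -mulrBr; congr (_ * _).
rewrite /displacement l1_sum (bigD1_seq s) //= big1 => [|t ts].
  rewrite addr0 -[LHS]/(((s, s * k)%g == (s, h))%:R - ((s, k) == (s, h))%:R).
  by rewrite !xpair_eqE eqxx /= (can2_eq (mulKg s) (mulVKg s)).
rewrite -[LHS]/(((t, t * k)%g == (s, h))%:R - ((t, k) == (s, h))%:R).
by rewrite !xpair_eqE (negbTE ts) subrr.
Qed.

(* Otherwise the displacements stay away from 0 on nonnegative combinations, and a separating
   functional is a family of bounded functions [u_s] with [\sum_s (u_s (s h) - u_s h) >= e],
   which an invariant mean does not allow. *)
Theorem reiter (G : groupType) (S : seq G) (e : R) : amenable R G -> 0 < e ->
  exists2 phi : G -> R, almost_invariant S e phi &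
    exists F : seq G, forall h, h \notin F -> phi h = 0.
Proof.
move=> [m [mlin mpos m1 minv]] e0; apply: contrapT => none.
(* With repetitions the layer labelled [s] would count the displacement by [s] several times. *)
pose S' := undup S.
have [|f [fD fZ fle fK]] := @separate_cone R _ G (@l1_norm R _) (displacement S') e
  (l1_norm_sublinear _ _).
  move=> l l0; rewrite leNgt; apply/negP => lt; apply: none.
  set c := \sum_(ci <- l) ci.1 in lt.
  (* The strict inequality [lt] rules out total mass 0, so the combination can be normalised. *)
  have c0 : 0 < c.
    rewrite -(pmulr_rgt0 _ e0); apply: le_lt_trans lt.
    by rewrite -lee_fin l1_normE esum_ge0.
  (* A finite combination of point masses has finite support; [amplification_density] relies on
     this. *)
  exists (fun h => c^-1 * combination l h); last first.
    exists [seq ci.2 | ci <- l] => h hl; rewrite /combination big_seq big1 ?mulr0 // => ci cil.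
    case: eqP => [ch|]; last by rewrite mulr0.
    by case/negP: hl; rewrite -ch; exact: map_f.
  split=> [h||s sS].
  - by rewrite mulr_ge0 ?combination_ge0 // invr_ge0 ltW.
  - under eq_esum do rewrite EFinM.
    rewrite esumZl ?invr_ge0 ?(ltW c0) // => [|h]; last by rewrite lee_fin combination_ge0.
    by rewrite esum_combination // -EFinM mulVf // gt_eqF.
  have -> : e%:E = (c^-1%:E * (e * c)%:E)%E by rewrite -EFinM mulrCA mulVf ?mulr1 // gt_eqF.
  rewrite (eq_esum (b := fun h => (c^-1%:E *
      `|combination l (s^-1 * h)%g - combination l h|%:E)%E)) => [|h _]; last first.
    by rewrite -mulrBr normrM EFinM gtr0_norm ?invr_gt0.
  rewrite esumZl ?invr_ge0 ?(ltW c0) //; apply: lee_wpmul2l.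
    by rewrite lee_fin invr_ge0 ltW.
  apply: le_trans (_ : (_ <= (l1_norm (\sum_(ci <- l) ci.1 *: displacement S' ci.2)%R)%:E)%E) _;
    last by rewrite lee_fin ltW.
  have -> : \esum_(h in [set: G]) `|combination l (s^-1 * h)%g - combination l h|%:E =
      \esum_(h in [set: G]) `|(\sum_(ci <- l) ci.1 *: displacement S' ci.2) (s, h)|%:E.
    by apply: eq_esum => h _; rewrite (displacement_combination _ _ (undup_uniq S)) // mem_undup.
  rewrite l1_normE esum_pair //.
  apply: (@esum_ge_term _ _ (fun s => \esum_(h in [set: G])
     `|(\sum_(ci <- l) ci.1 *: displacement S' ci.2) (s, h)|%:E)%E) => t.
  exact: esum_ge0.
have fN x : f (- x) = - f x by rewrite -scaleN1r fZ mulN1r.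
pose u s h := f (delta R (s, h)).
have bu s : bounded_function (u s).
  exists 1 => h; rewrite ler_norml -(l1_norm_delta R (s, h)) fle andbT lerNl -fN.
  apply: le_trans (fle _) _; rewrite -lee_fin !l1_normE.
  by apply: le_esum => x _; rewrite lee_fin -[(- _ : l1 _ _) x]/(- (delta R (s, h) x)) normrN.
have bD a (v w : G -> R) : bounded_function v -> bounded_function w ->
    bounded_function (fun h => a * v h + w h).
  move=> [A vA] [B wB]; exists (`|a| * A + B) => h.
  by rewrite (le_trans (ler_normD _ _)) // normrM lerD // ler_wpM2l.
have bS s (v : G -> R) : bounded_function v -> bounded_function (fun h => v (s * h)%g).
  by move=> [A vA]; exists A => h.
have b0 (c : R) : bounded_function (fun _ : G => c) by exists `|c|.
have m0 : m (fun=> 0) = 0.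
  have := mlin 1 _ _ (b0 0) (b0 0).
  rewrite (_ : (fun _ => _) = fun=> 0); first by lra.
  by apply/funext => h; rewrite mul1r addr0.
pose w T h := \sum_(s <- T) (u s (s * h)%g - u s h).
have mw T : bounded_function (w T) /\ m (w T) = 0.
  elim: T => [|s T [bT mT]].
    have -> : w [::] = fun=> 0 by apply/funext => h; rewrite /w big_nil.
    by [].
  have -> : w (s :: T) = fun h => 1 * u s (s * h)%g + (-1 * u s h + w T h).
    by apply/funext => h; rewrite /w big_cons; ring.
  split; first by apply: (bD); [exact: bS|exact: bD].
  rewrite mlin; [|exact: bS|exact: bD].
  by rewrite mlin // minv // mT; ring.
have [bw mw0] := mw S'.
have wge h : e <= w S' h.
  apply: le_trans (fK h) _; rewrite /displacement /w.
  elim: {fK mw0 bw}S' => [|s T IH]; last by rewrite !big_cons fD fD fN lerD.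
  by rewrite !big_nil; have := fD 0 0; rewrite addr0; lra.
have := mpos (fun h => (- e) * 1 + w S' h) (bD _ _ _ (b0 1) bw).
rewrite (mlin _ _ _ (b0 1) bw) m1 mw0.
have h h' : 0 <= - e * 1 + w S' h' by have := wge h'; lra.
by move=> /(_ h); lra.
Qed.

Lemma esum_translate (G : groupType) (g : G) (a : G -> \bar R) :
  \esum_(h in [set: G]) a (g * h)%g = \esum_(h in [set: G]) a h.
Proof.
symmetry; apply: (@reindex_esum _ _ _ [set: G] _ (fun h => (g * h)%g)).
split=> // [h k _ _|h _]; first exact: mulgI.
by exists (g^-1 * h)%g => //; rewrite mulVKg.
Qed.

(* Averaging over [c^0, ..., c^(M-1)] makes the density [2 / M]-invariant under [c]; by
   commutativity this does not spoil the invariance under the other elements. *)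
Lemma reiter_abelian (G : groupType) (S : seq G) (e : R) : abelian_group G -> 0 < e ->
  exists phi : G -> R, almost_invariant S e phi.
Proof.
move=> comG e0; elim: S => [|c S [phi [phi0 phi1 phiS]]].
  by exists (fun h => (1%g == h)%:R); split=> //; exact: esum_delta.
pose M := (Num.bound (2 / e)).+1.
have M0 : 0 < M%:R :> R by rewrite ltr0n.
have Mbig : 2 / M%:R <= e.
  rewrite ler_pdivrMr // mulrC -ler_pdivrMr //.
  have e2 : 0 <= 2 / e by rewrite divr_ge0 // ltW.
  by apply: le_trans (ltW (archi_boundP e2)) _; rewrite ler_nat leqnSn.
pose phi' h := \sum_(i < M) (M%:R^-1 * phi ((c ^+ i)^-1 * h)%g).
have Mi0 : 0 <= M%:R^-1 :> R by rewrite invr_ge0 ltW.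
have phi_tr g : \esum_(h in [set: G]) (phi (g * h)%g)%:E = 1%E.
  by rewrite (esum_translate g (fun h => (phi h)%:E)).
exists phi'; split=> [h||s].
- by rewrite sumr_ge0 // => i _; rewrite mulr_ge0.
- rewrite /phi'; under eq_esum do rewrite -sumEFin.
  rewrite esum_sum => [|h i _ _]; last by rewrite lee_fin mulr_ge0.
  rewrite (eq_bigr (fun=> (M%:R^-1)%:E)) => [|i _].
    by rewrite sumEFin sumr_const card_ord -[_ *+ M]mulr_natr mulVf // gt_eqF.
  under eq_esum do rewrite EFinM.
  by rewrite esumZl // ?phi_tr ?mule1 // => h; rewrite lee_fin.
rewrite inE => /orP[/eqP ->|sS].
  apply: le_trans (_ : _ <= (2 / M%:R)%:E)%E _; last by rewrite lee_fin.
  apply: (@le_trans _ _ (\esum_(h in [set: G]) ((M%:R^-1)%:E * (phi ((c ^+ M)^-1 * h)%g)%:E +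
      (M%:R^-1)%:E * (phi h)%:E))%E).
    apply: le_esum => h _; rewrite -!EFinM -EFinD lee_fin.
    (* The averages telescope: only the two end terms survive, each of mass [1 / M]. *)
    have -> : phi' (c^-1 * h)%g - phi' h =
        M%:R^-1 * phi ((c ^+ M)^-1 * h)%g - M%:R^-1 * phi h.
      have -> : phi' (c^-1 * h)%g = \sum_(i < M) (M%:R^-1 * phi ((c ^+ i.+1)^-1 * h)%g).
        by apply: eq_bigr => i _; rewrite mulgA -invgM -expgS.
      rewrite /phi' /M big_ord_recr [X in _ - X]big_ord_recl /= expg0 invg1 mul1g.
      by rewrite (eq_bigr (fun i : 'I_M.-1 => M%:R^-1 * phi ((c ^+ i.+1)^-1 * h)%g)) // /M; ring.
    by rewrite (le_trans (ler_normB _ _)) // !ger0_norm // mulr_ge0.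
  rewrite esumD; [|by move=> h _; rewrite mule_ge0 // lee_fin..].
  rewrite !esumZl //; [|by move=> h; rewrite lee_fin..].
  by rewrite phi_tr phi1 !mule1 -EFinD lee_fin mulrDl mul1r.
apply: (@le_trans _ _ (\esum_(h in [set: G]) \sum_(i < M) ((M%:R^-1)%:E *
    `|phi (s^-1 * ((c ^+ i)^-1 * h))%g - phi ((c ^+ i)^-1 * h)%g|%:E))%E).
  apply: le_esum => h _; under eq_bigr do rewrite -EFinM.
  rewrite sumEFin lee_fin /phi' -sumrB (le_trans (ler_norm_sum _ _ _)) //.
  apply: ler_sum => i _; rewrite -mulrBr normrM (ger0_norm Mi0) ler_wpM2l //.
  by rewrite !mulgA (comG _ s^-1)%g.
rewrite esum_sum => [|h i _ _]; last by rewrite mule_ge0 // lee_fin.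
apply: (@le_trans _ _ (\sum_(i < M) (M%:R^-1 * e)%:E)%E).
  apply: lee_sum => i _; rewrite esumZl // EFinM; apply: lee_wpmul2l; first by rewrite lee_fin.
  by rewrite (esum_translate _ (fun h => `|phi (s^-1 * h)%g - phi h|%:E)) phiS.
by rewrite sumEFin lee_fin sumr_const card_ord -[_ *+ M]mulr_natl mulrA divff ?mul1r // gt_eqF.
Qed.

End invariant_densities.

(** * Homomorphisms, formal sums acting on functions, and characters *)

Section multiplicative_maps.
Variables (G G' : groupType) (f : {multiplicative G -> G'}).

Lemma multiplicative1 : f 1%g = 1%g.
Proof. by apply: (mulgI (f 1%g)); rewrite -gmulfM !mulg1. Qed.

Lemma multiplicativeV x : f x^-1%g = (f x)^-1%g.
Proof. by apply: (mulgI (f x)); rewrite -gmulfM !mulgV multiplicative1. Qed.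

End multiplicative_maps.

Section group_ring_action.
Variables (R : realType) (G : groupType).

(* A formal sum of pairs (coefficient, group element) stands for an element of C[G]. *)
Definition act (u : seq (R[i] * G)) (x : G -> R[i]) (y : G) : R[i] :=
  \sum_(cg <- u) cg.1 * x (cg.2^-1 * y)%g.

(** [x] is an arbitrary function: for [b] nonzero the right side is infinite outside l^2(G), so
    nothing is claimed there. For [b = 0] the product with [+oo] is 0, hence the strict positivity
    in many statements. *)
Definition op_le (u : seq (R[i] * G)) (b : R) : Prop :=
  forall x, (sqr_esum (act u x) <= (b ^+ 2)%:E * sqr_esum x)%E.

Definition character (chi : G -> R[i]) : Prop :=
  {morph chi : x y / (x * y)%g >-> x * y} /\ forall x, normc (chi x) = 1.

Lemma character_neq0 chi x : character chi -> chi x != 0.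
Proof.
move=> [_ chi1]; apply/eqP => chi0; have := chi1 x.
by rewrite chi0 normc0 => /esym /eqP; rewrite oner_eq0.
Qed.

End group_ring_action.

(** * Fibres over characters of N, and comparison of their norms *)

Section central_extension.
Variables (R : realType) (N H G : groupType).
Variables (i : {multiplicative N -> G}) (p : {multiplicative G -> H}).
Variables (sigma : H -> G) (nu : G -> N).
Hypothesis i_inj : injective i.
Hypothesis i_central : forall n g, (i n * g = g * i n)%g.
Hypothesis pi1 : forall n, p (i n) = 1%g.
Hypothesis psigma : forall h, p (sigma h) = h.
Hypothesis decomp : forall y, y = (i (nu y) * sigma (p y))%g.

Lemma p_mul_i n y : p (i n * y)%g = p y.
Proof. by rewrite gmulfM pi1 mul1g. Qed.

Lemma nu_mul_i n y : nu (i n * y)%g = (n * nu y)%g.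
Proof.
apply: i_inj; rewrite gmulfM; apply: (mulIg (sigma (p y))).
by rewrite -mulgA -decomp -(p_mul_i n y) -decomp.
Qed.

(** By centrality, left multiplication by [g] shifts the N-coordinate by an amount that depends only
    on the coset of [y]. These shifts [nu (g * sigma h)] play the role of the cocycle of the
    extension. *)
Lemma nu_mul_l g y : nu (g * y)%g = (nu y * nu (g * sigma (p y)))%g.
Proof.
by rewrite {1}(decomp y) mulgA -(i_central (nu y) g) -mulgA nu_mul_i.
Qed.

Definition equivariant (chi : N -> R[i]) (x : G -> R[i]) : Prop :=
  forall n y, x (i n * y)%g = chi n * x y.

(** Restriction to the section identifies the fibre with functions on H. For a character, [|x|] is
    constant on cosets of N, so the norm does not depend on the section. *)
Definition fibre_le (chi : N -> R[i]) (u : seq (R[i] * G)) (b : R) : Prop :=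
  forall x, equivariant chi x ->
    (sqr_esum (fun h => act u x (sigma h)) <= (b ^+ 2)%:E * sqr_esum (fun h => x (sigma h)))%E.

Lemma act_equivariant chi u x : equivariant chi x -> equivariant chi (act u x).
Proof.
move=> ex n y; rewrite /act mulr_sumr; apply: eq_bigr => -[c g] _ /=.
by rewrite mulgA -i_central -mulgA ex mulrCA.
Qed.

Lemma equivariant_norm chi x n y : character chi -> equivariant chi x ->
  normc (x (i n * y)%g) = normc (x y).
Proof. by move=> cchi ex; rewrite ex normcM cchi.2 mul1r. Qed.

Lemma equivariant_translate chi x g : character chi -> equivariant chi x ->
  sqr_esum (fun h => x (g * sigma h)%g) = sqr_esum (fun h => x (sigma h)).
Proof.
move=> cchi ex.
rewrite (@sqr_esum_reindex _ _ _ (fun h => (p g * h)%g) (fun h => x (sigma h))); last first.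
  by exists (fun h => ((p g)^-1 * h)%g) => h; rewrite ?mulKg ?mulVKg.
apply: eq_sqr_esum => h.
by rewrite [X in normc (x X) = _]decomp (equivariant_norm _ _ cchi ex) gmulfM psigma.
Qed.

Lemma normc_real (r : R) : normc r%:C%C = `|r|.
Proof. by rewrite /normc /= expr0n addr0 sqrtr_sqr. Qed.

Section amplification.
Variables (J : choiceType) (j : J -> N) (om : N -> R[i]) (k : H -> R) (d : R).
Hypothesis d0 : 0 <= d.
Hypothesis k1 : \esum_(h in [set: H]) (k h ^+ 2)%:E = 1%E.
Hypothesis om1 : forall n, sqr_esum (fun s => om (j s * n)%g) = 1%E.

(** There are two uses. With [J = N] and [om] the root of an almost invariant density,
    multiplication by the weight carries square summable fibre vectors into l^2(G). With [J] a point
    and [om = psi^-1], it carries the fibre at [chi psi] to the one at [chi]. *)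
Definition weight (y : G) : R[i] := om (nu y) * (k (p y))%:C%C.

Lemma sqr_esum_k h0 : sqr_esum (fun t => (k (h0 * t)%g)%:C%C : R[i]) = 1%E.
Proof.
rewrite -k1 -(esum_translate h0 (fun h => (k h ^+ 2)%:E)).
by apply: eq_esum => t _; rewrite normc_real real_normK // num_real.
Qed.

Lemma weight_mul_i n y : weight (i n * y)%g = om (n * nu y)%g * (k (p y))%:C%C.
Proof. by rewrite /weight nu_mul_i p_mul_i. Qed.

Lemma sqr_esum_weight y :
  sqr_esum (fun ts : H * J => weight (i (j ts.2) * y * sigma ts.1)%g) = 1%E.
Proof.
rewrite -(sqr_esum_k (p y)).
rewrite -(@sqr_esum_mul_pair1 _ H J (fun ts => om (j ts.2 * nu (y * sigma ts.1))%g));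
  last by move=> t /=; exact: om1.
by apply: eq_sqr_esum => -[t s] /=; rewrite -mulgA weight_mul_i gmulfM psigma.
Qed.

(** The change splits into [D1], where [om] is moved by a cocycle value, and [D2], where [k] is
    moved by [p g]. Each costs [d], hence [d + d]. *)
Lemma sqr_esum_weight_diff g y :
  (forall h, k ((p g)^-1 * h)%g != 0 -> forall n,
    (sqr_esum (fun s => (om (j s * n * nu (g^-1 * sigma h))%g - om (j s * n)%g)%R) <= (d ^+ 2)%:E)%E) ->
  (\esum_(h in [set: H]) ((k ((p g)^-1 * h)%g - k h) ^+ 2)%:E <= (d ^+ 2)%:E)%E ->
  (sqr_esum (fun ts : H * J => (weight (g^-1 * (i (j ts.2) * y) * sigma ts.1)%g
     - weight (i (j ts.2) * y * sigma ts.1)%g)%R) <= ((d + d) ^+ 2)%:E)%E.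
Proof.
move=> omg kg.
pose z t := (k ((p g)^-1 * (p y * t))%g)%:C%C : R[i].
pose dk t := (k ((p g)^-1 * (p y * t))%g - k (p y * t)%g)%:C%C : R[i].
pose m t := nu (y * sigma t)%g; pose c t := nu (g^-1 * sigma (p y * t))%g.
pose D1 (ts : H * J) := (om (j ts.2 * m ts.1 * c ts.1)%g - om (j ts.2 * m ts.1)%g) * z ts.1.
pose D2 (ts : H * J) := om (j ts.2 * m ts.1)%g * dk ts.1.
have E ts : weight (g^-1 * (i (j ts.2) * y) * sigma ts.1)%g
     - weight (i (j ts.2) * y * sigma ts.1)%g = D1 ts + D2 ts.
  case: ts => t s; rewrite /D1 /D2 /=.
  have -> : (g^-1 * (i (j s) * y) * sigma t = i (j s) * (g^-1 * (y * sigma t)))%g.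
    by rewrite !mulgA -i_central.
  rewrite -mulgA !weight_mul_i nu_mul_l !gmulfM psigma multiplicativeV mulgA /z /dk rmorphB /=.
  by rewrite -/(m t) -/(c t); ring.
rewrite (@eq_sqr_esum _ _ _ (fun ts => D1 ts + D2 ts)) => [|ts]; last by rewrite E.
apply: sqr_esumD => //.
  apply: (@le_trans _ _ ((d ^+ 2)%:E * sqr_esum z)%E); last first.
    rewrite /z (@eq_sqr_esum _ _ _ (fun t => (k ((p g)^-1 * p y * t)%g)%:C%C)) => [|t].
      by rewrite sqr_esum_k mule1.
    by rewrite mulgA.
  apply: (@sqr_esum_mul_pair _ _ _
    (fun ts => om (j ts.2 * m ts.1 * c ts.1)%g - om (j ts.2 * m ts.1)%g)) => [|t zt].
    exact: sqr_ge0.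
  have kt : k ((p g)^-1 * (p y * t))%g != 0 by apply: contra_neq zt => k0; rewrite /z k0.
  exact: omg kt (m t).
rewrite (@sqr_esum_mul_pair1 _ H J (fun ts => om (j ts.2 * m ts.1)%g));
  last by move=> t /=; exact: om1.
apply: le_trans kg; rewrite le_eqVlt; apply/orP; left; apply/eqP.
rewrite -(esum_translate (p y) (fun h => ((k ((p g)^-1 * h)%g - k h) ^+ 2)%:E)).
by apply: eq_esum => t _; rewrite normc_real real_normK // num_real.
Qed.

(* The isometry [x |-> (t |-> weight (. sigma t) x)] almost intertwines [act u], so a bound for
   [act u] on its range passes to [x] itself. *)
Lemma amplify (u : seq (R[i] * G)) (b B : R) (chi : N -> R[i]) (x : G -> R[i]) :
  0 <= b -> 0 < B -> b + (d + d) * \sum_(cg <- u) normc cg.1 <= B ->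
  character chi -> equivariant chi x ->
  (forall cg, cg \in u -> forall h, k ((p cg.2)^-1 * h)%g != 0 -> forall n,
    (sqr_esum (fun s => (om (j s * n * nu (cg.2^-1 * sigma h))%g - om (j s * n)%g)%R) <=
       (d ^+ 2)%:E)%E) ->
  (forall cg, cg \in u ->
    (\esum_(h in [set: H]) ((k ((p cg.2)^-1 * h)%g - k h) ^+ 2)%:E <= (d ^+ 2)%:E)%E) ->
  (forall t, let f y := weight (y * sigma t)%g * x y in
    (sqr_esum (fun hs : H * J => act u f (i (j hs.2) * sigma hs.1)%g) <=
     (b ^+ 2)%:E * sqr_esum (fun hs : H * J => f (i (j hs.2) * sigma hs.1)%g))%E) ->
  (sqr_esum (fun h => act u x (sigma h)) <=
   (B ^+ 2)%:E * sqr_esum (fun h => x (sigma h)))%E.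
Proof.
move=> b0 B0 bB cchi ex omu ku opu.
apply: sqr_esum_scaled => // A A0 xA.
pose f t y := weight (y * sigma t)%g * x y.
(* In [a = (h, (t, s))] the entries [h] and [s] give the point of G, and [t] is the parameter of the
   amplification. *)
pose pt (a : H * (H * J)) := (i (j a.2.2) * sigma a.1)%g.
have wE (a : H * (H * J)) (v : G -> R[i]) : equivariant chi v ->
    normc (weight (pt a * sigma a.2.1)%g * v (pt a)) =
    normc (weight (pt a * sigma a.2.1)%g * v (sigma a.1)).
  by move=> ev; rewrite !normcM (equivariant_norm _ _ cchi ev).
have isom (v : G -> R[i]) : equivariant chi v ->
    sqr_esum (fun a => weight (pt a * sigma a.2.1)%g * v (pt a)) =
    sqr_esum (fun h => v (sigma h)).
  move=> ev; rewrite (eq_sqr_esum (fun a => wE a v ev)).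
  apply: (@sqr_esum_mul_pair1 _ H (H * J)%type
    (fun a => weight (pt a * sigma a.2.1)%g) (fun h => v (sigma h))) => h.
  by rewrite /pt /= -{1}(sqr_esum_weight (sigma h)).
rewrite -(isom _ (act_equivariant u ex)).
pose F (a : H * (H * J)) := act u (f a.2.1) (pt a).
pose D (cg : R[i] * G) (a : H * (H * J)) :=
  weight (cg.2^-1 * pt a * sigma a.2.1)%g - weight (pt a * sigma a.2.1)%g.
pose Er (a : H * (H * J)) := \sum_(cg <- u) (cg.1 * D cg a * x (cg.2^-1 * pt a)%g).
(* [Er] is the commutator of [act u] with multiplication by the weight. *)
have split_F a : weight (pt a * sigma a.2.1)%g * act u x (pt a) = F a - Er a.
  rewrite /F /Er /act mulr_sumr -sumrB; apply: eq_bigr => cg _.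
  by rewrite /f /D; ring.
rewrite (@eq_sqr_esum _ _ _ (fun a => F a - Er a)) => [|a]; last by rewrite split_F.
have Fle : (sqr_esum F <= ((b * A) ^+ 2)%:E)%E.
  (* The bound [opu] holds for each fixed [t]; exchanging [h] and [t] makes [t] the outer summation
     variable. *)
  pose sw (a : H * (H * J)) := (a.2.1, (a.1, a.2.2)).
  have swb : bijective sw by exists sw; case=> ? [].
  rewrite (sqr_esum_reindex F swb) sqr_esum_pair.
  apply: (@le_trans _ _ (\esum_(t in [set: H]) ((b ^+ 2)%:E *
     sqr_esum (fun hs : H * J => f t (i (j hs.2) * sigma hs.1)%g)))%E).
    by apply: le_esum => t _; exact: opu.
  rewrite esumZl ?sqr_ge0 // => [|t]; last exact: sqr_esum_ge0.
  rewrite exprMn [X in (_ <= X)%E]EFinM; apply: lee_wpmul2l; first by rewrite lee_fin sqr_ge0.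
  apply: le_trans xA; rewrite -(isom _ ex) (sqr_esum_reindex _ swb) sqr_esum_pair.
  exact: le_esum.
have Erle : (sqr_esum Er <= (((d + d) * (\sum_(cg <- u) normc cg.1) * A) ^+ 2)%:E)%E.
  have dd0 : 0 <= d + d by rewrite addr_ge0.
  rewrite mulr_sumr mulr_suml.
  apply: sqr_esum_sum => [cg|cg cgu]; first by rewrite !mulr_ge0 // normc_ge0.
  rewrite (@eq_sqr_esum _ _ _ (fun a => cg.1 * (D cg a * x (cg.2^-1 * sigma a.1)%g))); last first.
    move=> a; rewrite -mulrA !normcM; congr (_ * (_ * _)).
    by rewrite /pt mulgA -i_central -mulgA (equivariant_norm _ _ cchi ex).
  rewrite sqr_esumZ (_ : (d + d) * _ * A = normc cg.1 * ((d + d) * A)); last by ring.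
  rewrite exprMn [X in (_ <= X)%E]EFinM; apply: lee_wpmul2l; first by rewrite lee_fin sqr_ge0.
  rewrite exprMn [X in (_ <= X)%E]EFinM.
  apply: (@le_trans _ _ (((d + d) ^+ 2)%:E * sqr_esum (fun h => x (cg.2^-1 * sigma h)%g))%E).
    apply: (@sqr_esum_mul_pair _ H (H * J)%type (D cg)
      (fun h => x (cg.2^-1 * sigma h)%g)) => [|h _]; first exact: sqr_ge0.
    exact: (@sqr_esum_weight_diff cg.2 (sigma h) (omu cg cgu) (ku cg cgu)).
  by rewrite (equivariant_translate _ cchi ex); apply: lee_wpmul2l; rewrite ?lee_fin ?sqr_ge0.
have bA0 : 0 <= b * A by rewrite mulr_ge0.
have LA0 : 0 <= (d + d) * (\sum_(cg <- u) normc cg.1) * A.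
  by rewrite !mulr_ge0 ?addr_ge0 // sumr_ge0 // => cg _; exact: normc_ge0.
apply: le_trans (sqr_esumB bA0 LA0 Fle Erle) _.
rewrite lee_fin ler_sqr ?nnegrE ?addr_ge0 //; last by rewrite mulr_ge0 // ltW.
by rewrite -mulrDl ler_wpM2r.
Qed.

End amplification.

Lemma nu_sigma h : nu (sigma h) = 1%g.
Proof.
apply: i_inj; apply: (mulIg (sigma h)).
by rewrite -{2}(psigma h) -decomp multiplicative1 mul1g.
Qed.

Lemma sqr_esum_fibred (x : G -> R[i]) :
  sqr_esum (fun hn : H * N => x (i hn.2 * sigma hn.1)%g) = sqr_esum x.
Proof.
rewrite [RHS](@sqr_esum_reindex _ _ _ (fun hn : H * N => (i hn.2 * sigma hn.1)%g)) //.
exists (fun y => (p y, nu y)) => [[h n]|y]; last by rewrite /= -decomp.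
by rewrite /= p_mul_i psigma nu_mul_i nu_sigma mulg1.
Qed.

Lemma sqr_esum_unit (x : G -> R[i]) :
  sqr_esum (fun hs : H * unit => x (i 1%g * sigma hs.1)%g) = sqr_esum (fun h => x (sigma h)).
Proof.
rewrite [RHS](@sqr_esum_reindex _ _ _ (fun hs : H * unit => hs.1)) //; last first.
  by exists (fun h => (h, tt)) => [[h []]|h].
by apply: eq_sqr_esum => hs; rewrite multiplicative1 mul1g.
Qed.

(** For nonnegative [a] and [b], [(a - b)^2 <= |a^2 - b^2|], so square roots turn almost invariance
    in l^1 into almost invariance in l^2. *)
Lemma sqrt_density (X : groupType) (S : seq X) (d : R) (phi : X -> R) :
  almost_invariant S (d ^+ 2) phi ->
  \esum_(h in [set: X]) (Num.sqrt (phi h) ^+ 2)%:E = 1%E /\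
  forall s, s \in S -> (\esum_(h in [set: X])
    ((Num.sqrt (phi (s^-1 * h)%g) - Num.sqrt (phi h)) ^+ 2)%:E <= (d ^+ 2)%:E)%E.
Proof.
move=> [phi0 phi1 phiS]; split.
  by rewrite -phi1; apply: eq_esum => h _; rewrite sqr_sqrtr.
move=> s sS; apply: le_trans (phiS s sS); apply: le_esum => h _; rewrite lee_fin.
have le (a b : R) : 0 <= a -> 0 <= b -> (a - b) ^+ 2 <= `|a ^+ 2 - b ^+ 2|.
  move=> a0 b0; rewrite subr_sqr normrM -[(a - b) ^+ 2]real_normK ?num_real //.
  rewrite expr2 ler_wpM2l // (ger0_norm (addr_ge0 a0 b0)).
  by rewrite (le_trans (ler_normB _ _)) // !ger0_norm.
by have := le _ _ (sqrtr_ge0 (phi (s^-1 * h)%g)) (sqrtr_ge0 (phi h)); rewrite !sqr_sqrtr.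
Qed.

Lemma amplification_scale (u : seq (R[i] * G)) (e : R) : 0 < e ->
  exists2 d : R, 0 < d & (d + d) * \sum_(cg <- u) normc cg.1 <= e.
Proof.
move=> e0; set L := \sum_(cg <- u) _.
have L0 : 0 <= L by rewrite sumr_ge0 // => cg _; exact: normc_ge0.
(* The summand 1 keeps the denominator positive when all coefficients are 0. *)
exists (e / (2 * (L + 1))); first by rewrite divr_gt0 // mulr_gt0 // ltr_wpDl.
have -> : e / (2 * (L + 1)) + e / (2 * (L + 1)) = e / (L + 1) by field; rewrite gt_eqF // ltr_wpDl.
by rewrite mulrAC ler_pdivrMr ?ltr_wpDl // ler_pM2l // lerDl.
Qed.

(** [C] is finite because [u] and the support of the density are: it collects the cocycle values at
    the points where the translated weight is nonzero. *)
Lemma amplification_density (u : seq (R[i] * G)) (d : R) : amenable R H -> 0 < d ->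
  exists (k : H -> R) (C : seq N),
  [/\ \esum_(h in [set: H]) (k h ^+ 2)%:E = 1%E,
      forall cg, cg \in u ->
        (\esum_(h in [set: H]) ((k ((p cg.2)^-1 * h)%g - k h) ^+ 2)%:E <= (d ^+ 2)%:E)%E &
      forall cg, cg \in u -> forall h, k ((p cg.2)^-1 * h)%g != 0 ->
        nu (cg.2^-1 * sigma h)%g \in C].
Proof.
move=> amH d0.
have [phi phiS [F phiF]] := reiter [seq p cg.2 | cg <- u] amH (exprn_gt0 2 d0).
have [k1 kS] := sqrt_density phiS.
exists (fun h => Num.sqrt (phi h)).
exists [seq nu (cg.2^-1 * sigma (p cg.2 * f))%g | cg <- u, f <- F]; split=> // [cg cgu|cg cgu h kn0].
  by apply: kS; apply/mapP; exists cg.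
apply/allpairsP; exists (cg, ((p cg.2)^-1 * h)%g); split => //=; last by rewrite mulVKg.
by apply: contraNT kn0 => /phiF ->; rewrite sqrtr0.
Qed.

(** This says that the representation on the fibre is weakly contained in the regular representation
    of G. *)
Lemma op_le_fibre (chi : N -> R[i]) (u : seq (R[i] * G)) (b e : R) :
  abelian_group N -> amenable R H -> character chi -> 0 <= b -> 0 < e ->
  op_le u b -> fibre_le chi u (b + e).
Proof.
move=> comN amH cchi b0 e0 ub x ex.
have [d d0 dle] := amplification_scale u e0.
have [k [C [k1 kS kC]]] := amplification_density u amH d0.
(* Almost invariance concerns translation by [s^-1], whereas the cocycle translates by [c]; hence
   the inverses. *)
have [phi phiS] := reiter_abelian [seq c^-1%g | c <- C] comN (exprn_gt0 2 d0).
have [w1 wS] := sqrt_density phiS.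
pose om n := (Num.sqrt (phi n))%:C%C : R[i].
apply: (@amplify N id om k d (ltW d0) k1 _ u b (b + e) chi x) => //.
- move=> n; rewrite -w1 -(esum_translate n (fun h => (Num.sqrt (phi h) ^+ 2)%:E)).
  by apply: eq_esum => s _; rewrite normc_real real_normK ?num_real // comN.
- by rewrite ltr_wpDl.
- by rewrite lerD2l.
- move=> cg cgu h kn0 n; set c := nu _.
  have := wS c^-1%g (map_f _ (kC _ cgu _ kn0)); rewrite invgK; apply: le_trans.
  rewrite -(esum_translate n (fun h => ((Num.sqrt (phi (c * h)%g) - Num.sqrt (phi h)) ^+ 2)%:E)).
  apply: le_esum => s _.
  rewrite (_ : normc _ = `|Num.sqrt (phi (s * n * c)%g) - Num.sqrt (phi (s * n)%g)|).
    by rewrite real_normK ?num_real // (comN s n) (comN _ c).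
  by rewrite /om -(rmorphB (real_complex R)) normc_real.
- move=> t; pose f y := weight om k (y * sigma t)%g * x y.
  by have := ub f; rewrite -(sqr_esum_fibred (act u f)) -(sqr_esum_fibred f).
Qed.

(** Multiplication by [psi^-1 \o nu] fails to commute with [u] only by the values of [psi] on the
    cocycle, and the cutoff [k] reduces these to [C]. Both [C] and [d] are chosen before the
    characters, as a path of characters requires. *)
Lemma fibre_le_close (u : seq (R[i] * G)) (e : R) : amenable R H -> 0 < e ->
  exists (C : seq N) (d : R), 0 < d /\
    forall (chi psi : N -> R[i]) (b : R), character chi -> character psi ->
      (forall c, c \in C -> normc (psi c - 1) <= d) -> 0 <= b ->
      fibre_le chi u b -> fibre_le (fun n => chi n * psi n) u (b + e).
Proof.
move=> amH e0; have [d d0 dle] := amplification_scale u e0.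
have [k [C [k1 kS kC]]] := amplification_density u amH d0.
exists C, d; split => // chi psi b cchi cpsi psiC b0 ub x ex.
have normV n : normc (psi n)^-1 = 1 by rewrite normcV cpsi.2 invr1.
have esum_unit (a : R) : 0 <= a -> \esum_(s in [set: unit]) a%:E = a%:E.
  move=> a0; rewrite (_ : [set: unit] = [set tt]) ?esum_set1 //.
  by apply/seteqP; split => -[].
pose om n := (psi n)^-1.
apply: (@amplify unit (fun=> 1%g) om k d (ltW d0) k1 _ u b (b + e) (fun n => chi n * psi n) x) => //.
- move=> n; rewrite /sqr_esum (eq_esum (b := fun=> 1%E)) ?esum_unit // => s _.
  by rewrite /om normV expr1n.
- by rewrite ltr_wpDl.
- by rewrite lerD2l.
- split=> [n m|n]; first by rewrite cchi.1 cpsi.1; ring.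
  by rewrite normcM cchi.2 cpsi.2 mulr1.
- move=> cg cgu h kn0 n; set c := nu _.
  rewrite /sqr_esum esum_unit ?sqr_ge0 // lee_fin ler_sqr ?nnegrE ?normc_ge0 ?(ltW d0) //.
  have pc := character_neq0 c cpsi; have pn := character_neq0 n cpsi.
  have -> : om (1 * n * c)%g - om (1 * n)%g = - (psi n)^-1 * (psi c)^-1 * (psi c - 1).
    by rewrite /om mul1g cpsi.1; field; rewrite pc pn.
  by rewrite !normcM normcN !normV !mul1r; apply: psiC; exact: kC kn0.
move=> t; pose f y := weight om k (y * sigma t)%g * x y.
have ef : equivariant chi f.
  move=> n y; rewrite /f ex -mulgA weight_mul_i /weight /om cpsi.1.
  by field; rewrite !character_neq0.
by have := ub f ef; rewrite -(sqr_esum_unit (act u f)) -(sqr_esum_unit f).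
Qed.

End central_extension.

(** * Characters from real homomorphisms, and recovery of coefficients *)

Section real_characters.
Variable R : realType.

Definition cis (t : R) : R[i] := (cos t +i* sin t)%C.

Lemma cisD s t : cis (s + t) = cis s * cis t.
Proof. by rewrite /cis cosD sinD; congr (_ +i* _)%C; rewrite addrC. Qed.

Lemma cis0 : cis 0 = 1.
Proof. by rewrite /cis cos0 sin0. Qed.

Lemma cispi : cis pi = -1.
Proof. by rewrite /cis cospi sinpi; apply/eqP; rewrite eq_complex /= oppr0 !eqxx. Qed.

Lemma normc_cis t : normc (cis t) = 1.
Proof. by rewrite /normc /= cos2Dsin2 sqrtr1. Qed.

(** Since [|cis t - 1|^2 = 2 (1 - cos t)], continuity of the cosine at 0 suffices, with tolerance
    [d^2 / 2]. *)
Lemma cis_near1 (d : R) : 0 < d ->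
  exists2 r : R, 0 < r & forall t, `|t| < r -> normc (cis t - 1) <= d.
Proof.
move=> d0; have d20 : 0 < d ^+ 2 / 2 by rewrite divr_gt0 // exprn_gt0.
have := @continuous_cos R 0; rewrite /continuous_at cos0.
move=> /cvgrPdist_lt /(_ _ d20) near0.
have [r r0 {}near0] := (nbhs_ballP _ _).1 near0.
exists r => // t tr; have : ball (0 : R) r t by rewrite /ball /= sub0r normrN.
move=> /near0 cost; rewrite /= in cost.
have -> : normc (cis t - 1) = Num.sqrt ((cos t - 1) ^+ 2 + sin t ^+ 2).
  by rewrite /normc /= subr0.
rewrite -(ler_sqr) ?nnegrE ?sqrtr_ge0 ?(ltW d0) // sqr_sqrtr ?addr_ge0 ?sqr_ge0 //.
have := cos2Dsin2 t; have := ler_norm (1 - cos t); nra.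
Qed.

Definition real_hom (N : groupType) (phi : N -> R) : Prop :=
  {morph phi : x y / (x * y)%g >-> x + y}.

Lemma real_hom1 (N : groupType) (phi : N -> R) : real_hom phi -> phi 1%g = 0.
Proof. by move=> h; have := h 1%g 1%g; rewrite mulg1; lra. Qed.

Lemma character_cis (N : groupType) (phi : N -> R) : real_hom phi -> character (cis \o phi).
Proof.
by move=> h; split=> [x y|x]; [rewrite -cisD -h|exact: normc_cis].
Qed.

Section extension.
Variables (N : groupType).
Hypothesis comN : abelian_group N.
Hypothesis tfN : torsion_free N.

(** The graph of a homomorphism from a subgroup of N to the reals. As graphs are sets of pairs, the
    union of a chain serves as its upper bound in Zorn's lemma. *)
Record partial_hom (Gamma : set (N * R)) : Prop := PartialHom {
  partial_homM : forall x y s t, Gamma (x, s) -> Gamma (y, t) -> Gamma ((x * y)%g, s + t);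
  partial_homV : forall x s, Gamma (x, s) -> Gamma (x^-1%g, - s);
  partial_hom1 : Gamma (1%g, 0);
  partial_hom_eq0 : forall s, Gamma (1%g, s) -> s = 0 }.

Lemma partial_homX Gamma x s k : partial_hom Gamma ->
  Gamma (x, s) -> Gamma ((x ^+ k)%g, k%:R * s).
Proof.
move=> hG xs; elim: k => [|k IH]; first by rewrite expg0 mul0r; exact: partial_hom1.
by rewrite expgS -nat1r mulrDl mul1r; exact: partial_homM.
Qed.

Lemma partial_hom_inj Gamma x s t : partial_hom Gamma ->
  Gamma (x, s) -> Gamma (x, t) -> s = t.
Proof.
move=> hG xs /(partial_homV hG) xt.
have := partial_homM hG xs xt; rewrite mulgV => /(partial_hom_eq0 hG) /eqP.
by rewrite subr_eq0 => /eqP.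
Qed.

Lemma mulgC (x y : N) : (x * y = y * x)%g.
Proof. exact: comN. Qed.

Lemma mulgACA (x y z t : N) : ((x * y) * (z * t) = (x * z) * (y * t))%g.
Proof. by rewrite -!mulgA (mulgA y z t) (mulgC y z) -!mulgA. Qed.

(** The subgroup generated by [Gamma] and [(x, r)]; an integer exponent is the difference of the
    natural numbers [a] and [b]. *)
Definition adjoin (Gamma : set (N * R)) (x : N) (r : R) : set (N * R) :=
  [set zt | exists a b y s, [/\ Gamma (y, s), (zt.1 * x ^+ b = y * x ^+ a)%g
     & zt.2 = s + (a%:R - b%:R) * r]].

Lemma adjoin_partial_hom Gamma x r : partial_hom Gamma ->
  (forall m t, Gamma ((x ^+ m)%g, t) -> t = m%:R * r) -> partial_hom (adjoin Gamma x r).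
Proof.
move=> hG xr; split.
- move=> z z' t t' [a [b [y [s [Gy /= zE ->]]]]] [a' [b' [y' [s' [Gy' /= zE' ->]]]]].
  exists (a + a')%N, (b + b')%N, (y * y')%g, (s + s'); split => /=.
  + exact: partial_homM.
  + by rewrite !expgnDr mulgACA zE zE' mulgACA.
  + by rewrite !natrD; ring.
- move=> z t [a [b [y [s [Gy /= zE ->]]]]]; exists b, a, y^-1%g, (- s); split => /=.
  + exact: partial_homV.
  + apply: (mulgI (y * z)%g); rewrite [RHS]mulgACA mulgV mul1g (mulgC y z).
    by rewrite mulgACA mulgV mul1g zE.
  + by ring.
- by exists 0%N, 0%N, 1%g, 0; split => /=; [exact: partial_hom1|rewrite !mulg1|ring].
(* Here [y] is the power of [x] with exponent [b - a]; for a negative exponent [xr] is applied to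
   [y^-1]. *)
- move=> _ [a [b [y [s [Gy /= yE ->]]]]]; rewrite mul1g in yE.
  have [ab|ba] := leqP a b.
    have yE' : y = (x ^+ (b - a))%g.
      by apply: (mulIg (x ^+ a)%g); rewrite -expgnDr subnK // yE.
    by rewrite yE' in Gy; rewrite (xr _ _ Gy) natrB //; ring.
  have yE' : (y^-1 = x ^+ (a - b))%g.
    apply: (mulgI y); apply: (mulIg (x ^+ b)%g).
    by rewrite mulgV mul1g -mulgA -expgnDr subnK // ltnW.
  have := partial_homV hG Gy; rewrite yE' => /xr; rewrite natrB 1?ltnW // => sE.
  by rewrite -[s]opprK sE; ring.
Qed.

Lemma sub_adjoin Gamma x r : Gamma `<=` adjoin Gamma x r.
Proof.
by move=> [y s] Gy; exists 0%N, 0%N, y, s; split => //=; rewrite subrr mul0r addr0.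
Qed.

Lemma mem_adjoin Gamma x r : partial_hom Gamma -> adjoin Gamma x r (x, r).
Proof.
move=> hG; exists 1%N, 0%N, 1%g, 0; split => /=; first exact: partial_hom1.
  by rewrite expg0 expg1 mulg1 mul1g.
by rewrite subr0 mul1r add0r.
Qed.

(** If some power [x ^+ k] already has a value [s], divisibility of the reals gives [r = s / k].
    Otherwise the value at [x] is free, and 0 is taken. *)
Lemma partial_hom_extend Gamma x : partial_hom Gamma ->
  exists2 r, adjoin Gamma x r (x, r) & partial_hom (adjoin Gamma x r).
Proof.
move=> hG.
have [[k [s [k0 Gk]]]|none] := pselect (exists k s, (0 < k)%N /\ Gamma ((x ^+ k)%g, s)).
  have kn0 : k%:R != 0 :> R by rewrite pnatr_eq0 -lt0n.
  exists (s / k%:R); first exact: mem_adjoin.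
  apply: adjoin_partial_hom => // m t Gm; apply: (mulfI kn0).
  have := partial_homX k hG Gm; have := partial_homX m hG Gk.
  rewrite -!expgnA mulnC => e1 e2; rewrite (partial_hom_inj hG e2 e1).
  by field.
exists 0; first exact: mem_adjoin.
apply: adjoin_partial_hom => // -[|m] t Gm; last by case: none; exists m.+1, t.
by rewrite mul0r; apply: (partial_hom_eq0 hG).
Qed.

(** Torsion-freeness makes [n0 ^+ m |-> m] well defined; a maximal extension is total by
    [partial_hom_extend]. *)
Theorem exists_real_hom n0 : n0 <> 1%g -> exists2 phi : N -> R, real_hom phi & phi n0 = 1.
Proof.
move=> n01; pose Gamma0 := adjoin [set (1%g, 0)] n0 1.
have h1 : partial_hom [set (1%g, 0) : N * R].
  split=> [x y s t [-> ->] [-> ->]|x s [-> ->]||s [->]] //=.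
  - by rewrite mulg1 addr0.
  - by rewrite invg1 oppr0.
have h0 : partial_hom Gamma0.
  apply: adjoin_partial_hom => // m t [nm ->]; case: m nm => [|m nm]; first by rewrite mul0r.
  by case: n01; exact: (tfN (ltn0Sn m) nm).
pose T := {Gamma | partial_hom Gamma /\ Gamma0 `<=` Gamma}.
pose t0 : T := exist _ Gamma0 (conj h0 (@subset_refl _ Gamma0)).
pose r : rel T := fun A B => `[< sval A `<=` sval B >].
have [|||[Gamma [hG sG]] Gmax] := @ZL_preorder T t0 r.
- by move=> A; apply/asboolP.
- by move=> A B C /asboolP h /asboolP h'; apply/asboolP; exact: subset_trans h'.
- move=> A totA; have [A0|/set0P[B0 AB0]] := eqVneq A set0; first by exists t0 => s; rewrite A0.
  pose U := \bigcup_(B in A) sval B.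
  have hU : partial_hom U.
    split.
    + move=> x y s t [B AB Bx] [C AC Cy].
      have [/asboolP BC|/asboolP CB] := totA _ _ AB AC.
        by exists C => //; apply: (partial_homM (svalP C).1) => //; exact: BC.
      by exists B => //; apply: (partial_homM (svalP B).1) => //; exact: CB.
    + by move=> x s [B AB Bx]; exists B => //; apply: (partial_homV (svalP B).1).
    + by exists B0 => //; exact: (partial_hom1 (svalP B0).1).
    + by move=> s [B AB Bs]; apply: (partial_hom_eq0 (svalP B).1).
  have sU : Gamma0 `<=` U by move=> z /(svalP B0).2 ?; exists B0.
  pose t1 : T := exist (fun G => partial_hom G /\ Gamma0 `<=` G) U (conj hU sU).
  by exists t1 => B AB; apply/asboolP => z Bz; exists B.
have total x : exists s, Gamma (x, s).
  have [s xs hs] := partial_hom_extend x hG.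
  have sub := @sub_adjoin Gamma x s.
  pose t1 : T := exist (fun G => partial_hom G /\ Gamma0 `<=` G) _
    (conj hs (subset_trans sG sub)).
  by have /asboolP le := Gmax t1 (asboolT sub); exists s; exact: le.
have [phi phiP] := choice total.
exists phi => [x y|]; first exact: (partial_hom_inj hG (phiP _) (partial_homM hG (phiP _) (phiP _))).
by apply: (partial_hom_inj hG (phiP _)); apply: (sG); exact: mem_adjoin.
Qed.

(* Averaging a character sum over [chi] and [chi * psi], where [psi n1 = - psi n0], kills the
   coefficient of [n1] and keeps the one of [n0]. *)
Lemma coefficient_bound (l : seq (R[i] * N)) (eta : R) (n0 : N) :
  (forall phi, real_hom phi -> normc (\sum_(cn <- l) cn.1 * cis (phi cn.2)) <= eta) ->
  normc (\sum_(cn <- l | cn.2 == n0) cn.1) <= eta.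
Proof.
have [s ls n0s] : exists2 s : seq N, (forall cn, cn \in l -> cn.2 = n0 \/ cn.2 \in s) & n0 \notin s.
  exists [seq n <- [seq cn.2 | cn <- l] | n != n0]; last by rewrite mem_filter eqxx.
  move=> cn cnl; have [->|ne] := eqVneq cn.2 n0; [by left|right].
  by rewrite mem_filter ne map_f.
elim: s l ls n0s => [|n1 s IH] l ls.
  (* Only terms at [n0] are left, and the zero homomorphism reads off their sum. *)
  move=> _ /(_ (fun=> 0)); rewrite [X in normc X](_ : _ = \sum_(cn <- l | cn.2 == n0) cn.1).
    by apply=> x y; rewrite addr0.
  rewrite big_seq [RHS]big_seq_cond; apply: eq_big => [cn|cn _]; last by rewrite cis0 mulr1.
  by case: (boolP (cn \in l)) => //= /ls [->|//]; rewrite eqxx.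
rewrite inE negb_or => /andP[n01 n0s] bound.
have ne : (n1 * n0^-1)%g <> 1%g.
  move=> e; move: n01; rewrite eq_sym -(inj_eq (mulIg n0^-1%g)) e mulgV eqxx //.
have [phi0 hphi0 phi01] := exists_real_hom ne.
pose psi n := pi * phi0 n.
have hpsi : real_hom psi by move=> x y; rewrite /psi hphi0 mulrDr.
(* The multiplier is 1 at [n0], and 0 at [n1] because [psi] takes the value [pi] at [n1 * n0^-1]. *)
pose f (cn : R[i] * N) := cn.1 * ((1 + cis (psi (cn.2 * n0^-1)%g)) / 2).
pose l' := [seq (f cn, cn.2) | cn <- l & cn.2 != n1].
have two : normc (2 : R[i]) = 2 by rewrite normcMn normc1.
have -> : \sum_(cn <- l | cn.2 == n0) cn.1 = \sum_(cn <- l' | cn.2 == n0) cn.1.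
  rewrite /l' big_map big_filter_cond /=; apply: eq_big => [cn|cn /eqP cn0].
    by case: (eqVneq cn.2 n0) => [->|]; rewrite ?n01 ?andbF.
  by rewrite /f cn0 mulgV real_hom1 // cis0 -mulr2n divff ?mulr1 // pnatr_eq0.
apply: IH => //.
  move=> _ /mapP[cn + ->] /=; rewrite mem_filter => /andP[cn1 /ls [->|]]; first by left.
  by rewrite inE (negbTE cn1) /=; right.
move=> phi hphi; rewrite /l' big_map big_filter /=.
have -> : \sum_(cn <- l | cn.2 != n1) f cn * cis (phi cn.2) = \sum_(cn <- l) f cn * cis (phi cn.2).
  rewrite [RHS](bigID (fun cn => cn.2 == n1)) /= [X in _ = X + _]big1 ?add0r // => cn /eqP cn1.
  by rewrite /f cn1 /psi phi01 mulr1 cispi subrr mul0r mulr0 mul0r.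
have -> : \sum_(cn <- l) f cn * cis (phi cn.2) =
    (\sum_(cn <- l) cn.1 * cis (phi cn.2) +
     cis (psi n0^-1%g) * \sum_(cn <- l) cn.1 * cis (phi cn.2 + psi cn.2)) / 2.
  rewrite mulr_sumr -big_split mulr_suml; apply: eq_bigr => cn _ /=.
  by rewrite /f hpsi !cisD; ring.
rewrite normcM normcV two ler_pdivrMr // (le_trans (le_normcD _ _)) // normcM normc_cis mul1r.
have b1 := bound _ hphi.
have b2 : normc (\sum_(cn <- l) cn.1 * cis (phi cn.2 + psi cn.2)) <= eta.
  by apply: (bound (fun n => phi n + psi n)) => x y; rewrite hphi hpsi; ring.
by lra.
Qed.

End extension.
End real_characters.

Arguments cis {R} t.

(** * Approximation of operators on l^2(G) by formal sums *)

Section formal_sums.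
Variables (R : realType) (G : groupType).
Implicit Types (u v : seq (R[i] * G)) (x : G -> R[i]) (y : G).

Definition opp_sum u : seq (R[i] * G) := [seq (- cg.1, cg.2) | cg <- u].

Definition mul_sum u v : seq (R[i] * G) :=
  [seq (a.1 * b.1, (a.2 * b.2)%g) | a <- u, b <- v].

Lemma act_cat u v x y : act (u ++ v) x y = act u x y + act v x y.
Proof. by rewrite /act big_cat. Qed.

Lemma act_opp u x y : act (opp_sum u) x y = - act u x y.
Proof. by rewrite /act big_map /= -sumrN; apply: eq_bigr => cg _; rewrite mulNr. Qed.

Lemma act_mul u v x y : act (mul_sum u v) x y = act u (act v x) y.
Proof.
rewrite /act big_allpairs_dep /=; apply: eq_bigr => a _; rewrite mulr_sumr.
by apply: eq_bigr => b _; rewrite invgM mulrA mulgA.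
Qed.

Lemma op_le_l2 u (b : R) : 0 < b ->
  (forall x : l2 R G, (sqr_esum (act u x) <= (b ^+ 2)%:E * sqr_esum x)%E) -> op_le u b.
Proof.
move=> b0 ub x; apply: sqr_esum_scaled => // A A0 xA.
have xl : x \in @square_summable R G.
  by apply/square_summableP; apply: le_lt_trans xA _; rewrite ltry.
apply: le_trans (ub (L2 xl)) _; rewrite exprMn [X in (_ <= X)%E]EFinM.
by apply: lee_wpmul2l; rewrite ?lee_fin ?sqr_ge0.
Qed.

Definition act_l2 u (x : l2 R G) : l2 R G :=
  \sum_(cg <- u) cg.1 *: left_translation cg.2 x.

Lemma act_l2E u (x : l2 R G) y : act_l2 u x y = act u x y.
Proof.
rewrite /act_l2 /act; elim: u => [|cg u IH]; first by rewrite !big_nil.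
by rewrite !big_cons -IH.
Qed.

Lemma left_regularE (f : {fsfun G -> R[i] with 0}) (x : l2 R G) :
  left_regular f x = act_l2 [seq (f g, g) | g <- finsupp f] x.
Proof. by rewrite /left_regular /act_l2 big_map. Qed.

Lemma sqr_l2_norm (x : l2 R G) : ((l2_norm x ^+ 2)%:E)%E = sqr_esum x.
Proof.
case: x => x xP; move/square_summableP: (xP) => fx; rewrite /l2_norm /=.
have x0 := sqr_esum_ge0 x.
rewrite sqr_sqrtr ?fine_ge0 // fineK // fin_numElt fx andbT.
exact: lt_le_trans (ltNyr 0) x0.
Qed.

Lemma l2_norm_le (x y : l2 R G) (M : R) : 0 <= M ->
  (l2_norm x <= M * l2_norm y) = (sqr_esum x <= (M ^+ 2)%:E * sqr_esum y)%E.
Proof.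
move=> M0; rewrite -!sqr_l2_norm -EFinM lee_fin -exprMn ler_sqr ?nnegrE ?sqrtr_ge0 //.
by rewrite mulr_ge0 // sqrtr_ge0.
Qed.

Definition approximates (T : l2 R G -> l2 R G) u (e : R) : Prop :=
  forall x : l2 R G,
    (sqr_esum (fun y => (T x y - act u x y)%R) <= (e ^+ 2)%:E * sqr_esum x)%E.

Definition op_bound (T : l2 R G -> l2 R G) (M : R) : Prop :=
  forall x : l2 R G, (sqr_esum (T x) <= (M ^+ 2)%:E * sqr_esum x)%E.

Lemma bounded_op_bound T : @bounded_operator R G T -> exists2 M : R, 0 < M & op_bound T M.
Proof.
move=> [M TM]; have [M0|M0] := ltP 0 M.
  by exists M => // x; rewrite -l2_norm_le ?(ltW M0).
exists 1 => // x; rewrite -l2_norm_le // (le_trans (TM x)) // ler_wpM2r ?sqrtr_ge0 //.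
exact: le_trans M0 _.
Qed.

Lemma approximatesW T u (d e : R) : 0 <= d -> d <= e -> approximates T u d -> approximates T u e.
Proof.
move=> d0 de Tu x; apply: le_trans (Tu x) _; apply: lee_wpmul2r; first exact: sqr_esum_ge0.
by rewrite lee_fin ler_sqr ?nnegrE // (le_trans d0).
Qed.

Lemma scaled_le (T' : choiceType) (z : T' -> R[i]) (x : l2 R G) (b A : R) :
  (sqr_esum x <= (A ^+ 2)%:E)%E ->
  (sqr_esum z <= (b ^+ 2)%:E * sqr_esum x)%E -> (sqr_esum z <= ((b * A) ^+ 2)%:E)%E.
Proof.
move=> xA /le_trans; apply; rewrite exprMn [X in (_ <= X)%E]EFinM.
by apply: lee_wpmul2l; rewrite ?lee_fin ?sqr_ge0.
Qed.

Lemma approximates_sub T u v (d e : R) : 0 < d -> 0 < e ->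
  approximates T u d -> approximates T v e -> op_le (u ++ opp_sum v) (d + e).
Proof.
move=> d0 e0 Tu Tv; apply: op_le_l2 => [|x]; first exact: addr_gt0.
apply: sqr_esum_scaled => [|A A0 xA]; first exact: addr_gt0.
have -> : (d + e) * A = e * A + d * A by ring.
rewrite (@eq_sqr_esum _ _ _ (fun y => (T x y - act v x y) - (T x y - act u x y))); last first.
  by move=> y; rewrite act_cat act_opp; congr normc; ring.
apply: sqr_esumB; rewrite ?mulr_ge0 ?(ltW d0) ?(ltW e0) //.
  exact: scaled_le xA (Tv x).
exact: scaled_le xA (Tu x).
Qed.

(** As [T T = T], one has [u u - u = (T - u) - (T - u) u - T (T - u)]. With [|u| <= M + d <= M + 1]
    the three terms cost [d], [d (M + 1)] and [M d]. *)
Lemma idempotent_approximation (T : {linear l2 R G -> l2 R G}) u (M d : R) :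
  T \o T =1 T -> 0 < M -> op_bound T M -> 0 < d -> d <= 1 -> approximates T u d ->
  op_le (mul_sum u u ++ opp_sum u) (d * (M + M + 2)).
Proof.
move=> TT M0 TM d0 d1 Tu; have Mp : 0 < M + M + 2 by rewrite addr_gt0 // addr_gt0.
apply: op_le_l2 => [|x]; first exact: mulr_gt0.
apply: sqr_esum_scaled => [|A A0 xA]; first exact: mulr_gt0.
have dA0 : 0 <= d * A by rewrite mulr_ge0 // ltW.
have Txu : (sqr_esum (fun y => (T x y - act u x y)%R) <= ((d * A) ^+ 2)%:E)%E.
  exact: scaled_le xA (Tu x).
have uxA : (sqr_esum (act_l2 u x) <= (((M + 1) * A) ^+ 2)%:E)%E.
  rewrite (@eq_sqr_esum _ _ _ (fun y => T x y - (T x y - act u x y))) => [|y]; last first.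
    by rewrite act_l2E; congr normc; ring.
  apply: (@le_trans _ _ ((M * A + d * A) ^+ 2)%:E).
    by apply: sqr_esumB => //; [rewrite mulr_ge0 // ltW|exact: scaled_le xA (TM x)].
  have MA0 : 0 <= M * A by rewrite mulr_ge0 // ltW.
  by rewrite lee_fin mulrDl ler_sqr ?nnegrE ?addr_ge0 ?mul1r // lerD2l ler_piMl.
have ux_Tux : (sqr_esum (fun y => (T (act_l2 u x) y - act u (act_l2 u x) y)%R) <=
    ((d * ((M + 1) * A)) ^+ 2)%:E)%E by exact: (scaled_le uxA (Tu _)).
have Txu' : (sqr_esum (T (T x - act_l2 u x)%R) <= ((M * (d * A)) ^+ 2)%:E)%E.
  apply: scaled_le (TM _); apply: le_trans Txu; apply: le_sqr_esum => y.
  by rewrite -act_l2E.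
have E y : act (mul_sum u u ++ opp_sum u) x y =
    (T x y - act u x y) - (T (act_l2 u x) y - act u (act_l2 u x) y) - T (T x - act_l2 u x) y.
  rewrite act_cat act_opp act_mul.
  have -> : act u (act u x) y = act u (act_l2 u x) y.
    by apply: eq_bigr => cg _; rewrite act_l2E.
  have -> : T (T x - act_l2 u x) = T x - T (act_l2 u x) by rewrite linearB -[T (T x)]/((T \o T) x) TT.
  by rewrite -[(_ - _ : l2 _ _) y]/(T x y - T (act_l2 u x) y); ring.
rewrite (eq_sqr_esum (fun y => congr1 _ (E y))).
have -> : d * (M + M + 2) * A = d * A + d * ((M + 1) * A) + M * (d * A) by ring.
have M10 : 0 <= d * ((M + 1) * A) by rewrite !mulr_ge0 ?addr_ge0 // ltW.
by apply: sqr_esumB => //; [exact: addr_ge0|rewrite mulr_ge0 // ltW|exact: sqr_esumB].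
Qed.

Lemma sqr_esum_tail x (e : R) : (sqr_esum x < +oo)%E -> 0 < e ->
  exists s : seq G, (sqr_esum (fun y => if y \in s then 0%R else x y) <= e%:E)%E.
Proof.
move=> fx e0; have x0 := sqr_esum_ge0 x.
have finx : sqr_esum x \is a fin_num by rewrite fin_numElt fx (lt_le_trans (ltNyr 0)).
have [_ [F [finF _] <-] ltF] := ub_ereal_sup_adherent e0 finx.
have [s FE] := (finite_seqP F).1 finF.
exists s; set t := (X in (X <= _)%E).
have a0 y : (0 <= (normc (x y) ^+ 2)%:E)%E by rewrite lee_fin sqr_ge0.
have tE : t = \esum_(y in ~` F) (normc (x y) ^+ 2)%:E.
  rewrite esum_mkcond; apply: eq_esum => y _; rewrite FE in_setC mem_setE.
  by case: ifP; rewrite ?normc0 ?expr0n.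
have := ltF; have : sqr_esum x = ((\sum_(y \in F) (normc (x y) ^+ 2)%:E) + t)%E.
  rewrite /sqr_esum (esumID F) // !setTI -tE; congr (_ + _)%E.
  by rewrite esum_fset.
rewrite -[ereal_sup _]/(sqr_esum x) => -> lt.
have t0 : (0 <= t)%E by exact: sqr_esum_ge0.
move: lt finx; rewrite /sqr_esum; set S := (\sum_(y \in F) _)%E.
move=> + _; have S0 : (0 <= S)%E by rewrite fsume_ge0.
case: (S) S0 (t) t0 => [S'| |] // S'0 [t'| |] // t'0.
- by rewrite -[X in (X < _)%E]/((S' + t' - e)%:E) lte_fin lee_fin; lra.
Qed.

End formal_sums.

(** * Vanishing of an idempotent on fibres, and its propagation *)

Section fibres.
Variables (R : realType) (N H G : groupType).
Variables (i : {multiplicative N -> G}) (p : {multiplicative G -> H}).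
Variables (sigma : H -> G) (nu : G -> N).
Hypothesis i_inj : injective i.
Hypothesis i_central : forall n g, (i n * g = g * i n)%g.
Hypothesis pi1 : forall n, p (i n) = 1%g.
Hypothesis psigma : forall h, p (sigma h) = h.
Hypothesis decomp : forall y, y = (i (nu y) * sigma (p y))%g.
Hypothesis comN : abelian_group N.
Hypothesis tfN : torsion_free N.
Hypothesis amH : amenable R H.

Local Notation fibre := (@fibre_le R N H G i sigma).

Lemma fibre_scaled (chi : N -> R[i]) u (b A : R) (x : G -> R[i]) :
  fibre chi u b -> equivariant i chi x ->
  (sqr_esum (fun h => x (sigma h)) <= (A ^+ 2)%:E)%E ->
  (sqr_esum (fun h => act u x (sigma h)) <= ((b * A) ^+ 2)%:E)%E.
Proof.
move=> ub ex xA; apply: le_trans (ub _ ex) _; rewrite exprMn [X in (_ <= X)%E]EFinM.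
by apply: lee_wpmul2l; rewrite ?lee_fin ?sqr_ge0.
Qed.

Lemma fibre_add chi u v (a b : R) : 0 <= a -> 0 <= b -> 0 < a + b ->
  fibre chi u a -> fibre chi v b -> fibre chi (u ++ v) (a + b).
Proof.
move=> a0 b0 ab ua vb x ex; apply: sqr_esum_scaled => // A A0 xA.
rewrite (@eq_sqr_esum _ _ _ (fun h => act u x (sigma h) + act v x (sigma h))) => [|h]; last first.
  by rewrite act_cat.
rewrite mulrDl; apply: sqr_esumD; rewrite ?mulr_ge0 //; first exact: (fibre_scaled ua ex xA).
exact: (fibre_scaled vb ex xA).
Qed.

Lemma fibreW chi u (a b : R) : 0 <= a -> a <= b -> fibre chi u a -> fibre chi u b.
Proof.
move=> a0 ab ua x ex; apply: le_trans (ua x ex) _; apply: lee_wpmul2r; first exact: sqr_esum_ge0.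
by rewrite lee_fin ler_sqr ?nnegrE // (le_trans a0).
Qed.

(* For a fibre vector [x] of norm at most [A], [|u x| <= |u u x| + |(u u - u) x| <= |u x| / 2 + d A]. *)
Lemma fibre_idempotent chi u (d : R) : 0 < d -> fibre chi u 2^-1 ->
  fibre chi (mul_sum u u ++ opp_sum u) d -> fibre chi u (2 * d).
Proof.
move=> d0 u2 ud x ex; apply: sqr_esum_scaled => [|A A0 xA]; first exact: mulr_gt0.
have uxA := fibre_scaled u2 ex xA.
set z := fun h => act u x (sigma h); rewrite -/z in uxA.
have z0 := sqr_esum_ge0 z.
have zfin : sqr_esum z \is a fin_num.
  by rewrite fin_numElt (lt_le_trans (ltNyr 0) z0) (le_lt_trans uxA (ltry _)).
pose B := Num.sqrt (fine (sqr_esum z)).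
have BE : sqr_esum z = (B ^+ 2)%:E by rewrite sqr_sqrtr ?fine_ge0 // fineK.
have B0 : 0 <= B by exact: sqrtr_ge0.
have dA0 : 0 <= d * A by rewrite mulr_ge0 // ltW.
have le : (sqr_esum z <= ((2^-1 * B + d * A) ^+ 2)%:E)%E.
  rewrite (@eq_sqr_esum _ _ z (fun h => act u (act u x) (sigma h)
     - act (mul_sum u u ++ opp_sum u) x (sigma h))) => [|h]; last first.
    by rewrite act_cat act_opp act_mul /z; congr normc; ring.
  apply: sqr_esumB => //; first by rewrite mulr_ge0.
    apply: (fibre_scaled u2); first exact: act_equivariant.
    by rewrite -BE.
  exact: (fibre_scaled ud ex xA).
have B2 : 0 <= 2^-1 * B by rewrite mulr_ge0.
have rhs0 : 0 <= 2^-1 * B + d * A by exact: addr_ge0.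
have dA2 : 0 <= 2 * d * A by rewrite -mulrA mulr_ge0.
have {}le : B <= 2^-1 * B + d * A.
  by rewrite -(ler_sqr _ _) ?nnegrE // -lee_fin -BE.
by rewrite BE lee_fin ler_sqr ?nnegrE //; lra.
Qed.

(** The difference of two approximants of [T] is small on l^2(G), hence on every fibre. The strict
    inequality pays for the loss in [op_le_fibre]. *)
Lemma fibre_approximates T chi u v (a b d e : R) : character chi ->
  approximates T u d -> approximates T v e -> 0 < d -> 0 < e -> 0 <= a ->
  a + (d + e) < b -> fibre chi v a -> fibre chi u b.
Proof.
move=> cchi Tu Tv d0 e0 a0 ab va.
have s0 : 0 < b - (a + (d + e)) by rewrite subr_gt0.
have de0 := addr_gt0 d0 e0.
have uv := op_le_fibre i_inj i_central pi1 psigma decomp comN amH cchi (ltW de0) s0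
  (approximates_sub d0 e0 Tu Tv).
have des0 := addr_gt0 de0 s0.
have := fibre_add a0 (ltW des0) (ltr_wpDl a0 des0) va uv.
have -> : a + (d + e + (b - (a + (d + e)))) = b by ring.
move=> vb x ex; have := vb x ex.
rewrite (@eq_sqr_esum _ _ _ (fun h => act u x (sigma h))) // => h.
by rewrite !act_cat act_opp; congr normc; ring.
Qed.

(** This expresses that the operator induced by [T] on the fibre is 0. One approximant for each [e]
    is enough, since [fibre_approximates] transfers smallness to the others. *)
Definition vanishes_at (T : l2 R G -> l2 R G) (chi : N -> R[i]) : Prop :=
  forall e, 0 < e -> exists2 u, approximates T u e & fibre chi u e.

Section idempotent.
Variable (T : {linear l2 R G -> l2 R G}) (M : R).
Hypothesis TT : T \o T =1 T.
Hypothesis M0 : 0 < M.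
Hypothesis TM : op_bound T M.
Hypothesis Tapprox : forall e, 0 < e -> exists u, approximates T u e.

(** A finer approximant [v] has fibre norm below 1/2, as [3/8 + 1/16 + 1/32 < 1/2]. Since [v v - v]
    is as small as desired, [fibre_idempotent] then makes [v] small. *)
Lemma vanishes_at_half chi u : character chi ->
  approximates T u 16^-1 -> fibre chi u (8^-1 * 3) -> vanishes_at T chi.
Proof.
move=> cchi Tu u38 e e0; pose K := M + M + 2.
have K0 : 0 < K by rewrite addr_gt0 // addr_gt0.
(* The last bound makes the defect [d K] at most [e / 4]; the passage to the fibre adds [e / 4], and
   [fibre_idempotent] doubles the total to [e]. *)
pose d := Num.min 32^-1 (Num.min e (e / (4 * K))).
have d0 : 0 < d by rewrite !lt_min !invr_gt0 e0 divr_gt0 ?mulr_gt0 // !ltr0n.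
have d32 : d <= 32^-1 by rewrite ge_min lexx.
have de : d <= e by rewrite !ge_min lexx /= orbT.
have dK : d * K <= e / 4.
  rewrite -ler_pdivlMr // -mulrA -invfM; apply: (@le_trans _ _ (e / (4 * K))) => //.
  by rewrite !ge_min lexx !orbT.
have [v Tv] := Tapprox d0; exists v; first exact: (approximatesW (ltW d0) de Tv).
have v2 : fibre chi v 2^-1.
  have i16 : 0 < 16^-1 :> R by rewrite invr_gt0.
  have i38 : 0 <= 8^-1 * 3 :> R by rewrite mulr_ge0.
  by apply: (fibre_approximates cchi Tv Tu d0 i16 i38 _ u38); lra.
have d1 : d <= 1 by lra.
have e4 : 0 < e / 4 by rewrite divr_gt0.
have vv := idempotent_approximation TT M0 TM d0 d1 Tv.
have dK0 : 0 <= d * K := mulr_ge0 (ltW d0) (ltW K0).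
have e2 : 0 < e / 2 by rewrite divr_gt0.
have := op_le_fibre i_inj i_central pi1 psigma decomp comN amH cchi dK0 e4 vv.
have le2 : d * K + e / 4 <= e / 2 by lra.
move=> /(fibreW (addr_ge0 dK0 (ltW e4)) le2) /(fibre_idempotent e2 v2).
by have -> : 2 * (e / 2) = e by field.
Qed.

(** A single approximant [u] of precision 1/16 serves all characters, so [C] and [d] are uniform.
    Its norm is at most 1/4 where [T] vanishes; moving to [chi psi] adds 1/8, which gives the 3/8 of
    [vanishes_at_half]. *)
Lemma vanishes_at_close : exists (C : seq N) (d : R), 0 < d /\
  forall chi psi, character chi -> character psi ->
    (forall c, c \in C -> normc (psi c - 1) <= d) ->
    vanishes_at T chi -> vanishes_at T (fun n => chi n * psi n).
Proof.
have i16 : 0 < 16^-1 :> R by rewrite invr_gt0.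
have i8 : 0 < 8^-1 :> R by rewrite invr_gt0.
have [u Tu] := Tapprox i16.
have [C [d [d0 close]]] := fibre_le_close i_inj i_central pi1 psigma decomp u amH i8.
exists C, d; split => // chi psi cchi cpsi psiC Tchi.
have [v Tv v16] := Tchi _ i16.
have u14 : fibre chi u (8^-1 * 2).
  by apply: (fibre_approximates cchi Tu Tv i16 i16 (ltW i16) _ v16); lra.
have i14 : 0 <= 8^-1 * 2 :> R by rewrite mulr_ge0.
have := close chi psi _ cchi cpsi psiC i14 u14.
have -> : 8^-1 * 2 + 8^-1 = 8^-1 * 3 :> R by ring.
apply: vanishes_at_half => //.
split=> [n m|n]; first by rewrite cchi.1 cpsi.1; ring.
by rewrite normcM cchi.2 cpsi.2 mulr1.
Qed.

Lemma vanishes_at_cis phi : vanishes_at T (fun=> 1) -> real_hom phi ->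
  vanishes_at T (cis \o phi).
Proof.
move=> T1 hphi; have [C [d [d0 close]]] := vanishes_at_close.
have [r r0 cisr] := cis_near1 d0.
pose S := \sum_(c <- C) `|phi c|.
have S0 : 0 <= S / r by rewrite divr_ge0 ?(ltW r0) // sumr_ge0.
(* Since [S] dominates every [|phi c|] with [c] in [C], each of the [n] steps moves the argument at
   [c] by less than [r]. *)
pose n := (Num.bound (S / r)).+1.
have n0 : 0 < n%:R :> R by rewrite ltr0n.
have Sn : S < n%:R * r.
  rewrite -ltr_pdivrMr //; apply: lt_le_trans (archi_boundP S0) _.
  by rewrite ler_nat leqnSn.
pose psi (t : R) m := t * phi m.
have hpsi t : real_hom (psi t) by move=> x y; rewrite /psi hphi mulrDr.
have step k : vanishes_at T (cis \o psi (k%:R / n%:R)).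
  elim: k => [|k IH].
    rewrite (_ : _ \o _ = fun=> 1) //; apply/funext => m /=.
    by rewrite /psi mul0r mul0r cis0.
  rewrite (_ : _ \o _ = fun m => (cis \o psi (k%:R / n%:R)) m * (cis \o psi n%:R^-1) m); last first.
    apply/funext => m; rewrite -[RHS]cisD; congr cis.
    by rewrite /psi -natr1; field; rewrite gt_eqF.
  apply: close IH; [exact: character_cis|exact: character_cis|].
  move=> c cC; apply: cisr; rewrite /psi normrM gtr0_norm ?invr_gt0 //.
  rewrite mulrC ltr_pdivrMr // mulrC; apply: le_lt_trans Sn.
  rewrite /S (perm_big _ (perm_to_rem cC)) big_cons lerDl sumr_ge0 //.
have := step n; rewrite (_ : _ \o _ = cis \o phi) //.
by apply/funext => m /=; rewrite /psi divff ?mul1r // gt_eqF.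
Qed.

Lemma act_point (u : seq (R[i] * G)) (z y : G) :
  act u (fun g => (g == z)%:R) y = \sum_(cg <- u | cg.2 == (y * z^-1)%g) cg.1.
Proof.
rewrite [RHS]big_mkcond; apply: eq_bigr => cg _.
have -> : ((cg.2^-1 * y)%g == z) = (cg.2 == (y * z^-1)%g).
  apply/eqP/eqP => [<-|->]; first by rewrite invgM invgK mulVKg.
  by rewrite invgM invgK -mulgA mulVg mulg1.
by case: ifP; rewrite ?mulr1 ?mulr0.
Qed.

(* The fibre vector [chi \o nu] over the point [1] of H turns the coefficients of [u] on the coset
   of [g] into a character sum. *)
Lemma coefficient_le (u : seq (R[i] * G)) (b : R) (g : G) : 0 <= b ->
  (forall phi, real_hom phi -> fibre (cis \o phi) u b) ->
  normc (\sum_(cg <- u | cg.2 == g) cg.1) <= b.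
Proof.
move=> b0 ub; pose h := p g; pose m := nu (g^-1 * sigma h)%g.
pose l := [seq (cg.1, nu (cg.2^-1 * sigma h)%g) | cg <- u & p cg.2 == h].
have -> : \sum_(cg <- u | cg.2 == g) cg.1 = \sum_(cn <- l | cn.2 == m) cn.1.
  rewrite /l big_map big_filter_cond; apply: eq_bigl => cg /=.
  apply/eqP/andP => [->|[/eqP pg /eqP num]]; first by rewrite !eqxx.
  apply: invg_inj; apply: (mulIg (sigma h)).
  rewrite [LHS]decomp [RHS]decomp num; congr (_ * sigma _)%g.
  by rewrite !gmulfM !multiplicativeV pg.
apply: (coefficient_bound comN tfN) => phi hphi.
pose x y := if p y == 1%g then cis (phi (nu y)) else 0.
have ex : equivariant i (cis \o phi) x.
  move=> n y; rewrite /x (p_mul_i pi1) (nu_mul_i i_inj pi1 decomp) /=.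
  by case: ifP => _; rewrite ?mulr0 // hphi cisD.
have x1 : (sqr_esum (fun h => x (sigma h)) <= (1 ^+ 2)%:E)%E.
  rewrite expr1n -(esum_delta R (1%g : H)); apply: le_esum => h' _; rewrite lee_fin /x psigma eq_sym.
  by case: ifP => _; rewrite ?normc_cis ?expr1n // normc0 expr0n.
have := fibre_scaled (ub _ hphi) ex x1; rewrite mulr1.
move=> /(le_trans (sqr_esum_ge _ h)); rewrite lee_fin ler_sqr ?nnegrE ?normc_ge0 //.
congr (normc _ <= _); rewrite /act /l big_map big_filter [RHS]big_mkcond /=.
apply: eq_bigr => cg _; rewrite /x gmulfM multiplicativeV psigma.
have -> : ((p cg.2)^-1 * h == 1)%g = (p cg.2 == h).
  by apply/eqP/eqP => [e|->]; rewrite ?mulVg // -[LHS]mulg1 -e mulVKg.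
by case: ifP; rewrite ?mulr0.
Qed.

Lemma point_square_summable (z : G) : (fun g => (g == z)%:R) \in @square_summable R G.
Proof.
apply/square_summableP; apply: (@le_lt_trans _ _ 1%E); last exact: ltry.
rewrite -(esum_delta R z); apply: le_esum => g _; rewrite lee_fin eq_sym.
by case: (z == g); rewrite ?normc1 ?normc0 ?expr1n ?expr0n.
Qed.

Definition point (z : G) : l2 R G := L2 (point_square_summable z).

Lemma sqr_esum_point z : (sqr_esum (point z) <= 1%E)%E.
Proof.
rewrite -(esum_delta R z); apply: le_esum => g _; rewrite lee_fin /= eq_sym.
by case: (z == g); rewrite ?normc1 ?normc0 ?expr1n ?expr0n.
Qed.

Lemma normc_le0 (z : R[i]) : (forall e : R, 0 < e -> normc z <= e) -> z = 0.
Proof.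
move=> ze; apply: eq0_normc; apply/eqP; rewrite eq_le normc_ge0 andbT.
by apply/ler_addgt0Pr => e e0; rewrite add0r ze.
Qed.

Lemma zero_at_point z : vanishes_at T (fun=> 1) -> T (point z) = 0.
Proof.
move=> T1; apply: val_inj; apply/funext => y /=; apply: normc_le0 => e e0.
(* On the fibres [u] is bounded by [4 d], as [d + (d + d) < 4 d]; replacing [T] by [u] costs one
   more [d], and [5 d < e]. *)
pose d := e / 6; have d0 : 0 < d by rewrite divr_gt0.
have [u Tu] := Tapprox d0.
have u4 phi : real_hom phi -> fibre (cis \o phi) u (4 * d).
  move=> hphi; have [v Tv vd] := vanishes_at_cis T1 hphi d0.
  apply: (fibre_approximates (character_cis hphi) Tu Tv d0 d0 (ltW d0) _ vd).
  by rewrite /d; lra.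
have d40 : 0 <= 4 * d by rewrite mulr_ge0 // ltW.
have := coefficient_le (y * z^-1)%g d40 u4; rewrite -act_point => le1.
have le2 : normc (T (point z) y - act u (point z) y) <= d.
  rewrite -ler_sqr ?nnegrE ?normc_ge0 ?(ltW d0) // -lee_fin.
  apply: (le_trans (sqr_esum_ge (fun y => T (point z) y - act u (point z) y) y)).
  apply: le_trans (Tu (point z)) _; rewrite -[X in (_ <= X)%E]mule1.
  by apply: lee_wpmul2l; [rewrite lee_fin sqr_ge0|exact: sqr_esum_point].
rewrite -[T (point z) y](subrK (act u (point z) y)).
apply: le_trans (le_normcD _ _) _; move: le1 le2; rewrite /d /=; lra.
Qed.

(** [T] is bounded and kills the point masses, whose span is dense; a tail of norm [e / M]
    contributes at most [e]. *)
Lemma zero_of_vanishing : vanishes_at T (fun=> 1) -> T =1 (fun=> 0).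
Proof.
move=> T1 x; apply: val_inj; apply/funext => y /=; apply: normc_le0 => e e0.
have e2 : 0 < (e / M) ^+ 2 by rewrite exprn_gt0 // divr_gt0.
have fx : (sqr_esum x < +oo)%E by case: (x) => ? ?; apply/square_summableP.
have [s tail] := sqr_esum_tail fx e2.
pose xs : l2 R G := \sum_(z <- undup s) x z *: point z.
have xsE g : xs g = if g \in s then x g else 0.
  have -> : xs g = \sum_(z <- undup s) x z * (g == z)%:R.
    by rewrite /xs; elim: (undup s) => [|z t IH]; rewrite ?big_nil // !big_cons -IH.
  case: ifP => gs.
    rewrite (bigD1_seq g) ?mem_undup ?undup_uniq //= eqxx mulr1 big1 ?addr0 // => z zg.
    by rewrite eq_sym (negbTE zg) mulr0.
  rewrite big_seq big1 // => z; rewrite mem_undup => zs.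
  by case: eqP => [gz|]; [rewrite gz zs in gs|rewrite mulr0].
have Txs : T xs = 0.
  by rewrite linear_sum big1 // => z _; rewrite linearZ /= zero_at_point // scaler0.
have Tx : T x = T (x - xs) by rewrite linearB Txs subr0.
rewrite -ler_sqr ?nnegrE ?normc_ge0 ?(ltW e0) // -lee_fin Tx.
apply: le_trans (sqr_esum_ge _ y) _; apply: le_trans (TM _) _.
have -> : e ^+ 2 = M ^+ 2 * (e / M) ^+ 2 by field; rewrite gt_eqF.
rewrite [X in (_ <= X)%E]EFinM; apply: lee_wpmul2l; first by rewrite lee_fin sqr_ge0.
apply: le_trans tail; apply: le_sqr_esum => g.
rewrite -[(_ - _ : l2 _ _) g]/(x g - xs g) xsE.
by case: ifP => _; rewrite ?subrr ?subr0.
Qed.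

End idempotent.
End fibres.

(** * Norm limits of Cauchy sequences of formal sums *)

Section limit_operators.
Variables (R : realType) (X : groupType).
Implicit Types (u : seq (R[i] * X)).

Lemma sqr_esum_le_fin (x : X -> R[i]) (B : \bar R) :
  (forall s : seq X, uniq s -> (sqr_esum (fun y => if y \in s then x y else 0%R) <= B)%E) ->
  (sqr_esum x <= B)%E.
Proof.
move=> fin; apply: ge_ereal_sup => _ [F [finF _] <-].
have [s FE] := (finite_seqP F).1 finF.
apply: le_trans (fin (undup s) (undup_uniq s)).
rewrite -esum_fset // => [|y _]; last by rewrite lee_fin sqr_ge0.
rewrite esum_mkcond; apply: le_esum => y _; rewrite FE mem_setE mem_undup.
by case: ifP => _; rewrite ?normc0 ?expr0n.
Qed.

(** The triangle inequality over the points of [s] gives a crude factor [size s], which is harmless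
    when [s] is fixed and [D] tends to 0. *)
Lemma sqr_esum_restrict (s : seq X) (x : X -> R[i]) (D : R) : uniq s ->
  (forall y, normc (x y) <= D) ->
  (sqr_esum (fun y => if y \in s then x y else 0%R) <= (((size s)%:R * D) ^+ 2)%:E)%E.
Proof.
move=> us xD; have D0 : 0 <= D := le_trans (normc_ge0 _) (xD 1%g).
have sumE : ((size s)%:R * D)%R = (\sum_(z <- s) D)%R.
  by rewrite big_const_seq count_predT iter_addr_0 mulr_natl.
pose xz (z : X) y : R[i] := if y == z then x y else 0.
rewrite sumE (@eq_sqr_esum _ _ _ (fun y => \sum_(z <- s) xz z y)) => [|y]; last first.
  case: ifP => ys.
    rewrite (bigD1_seq y) //= big1 ?addr0 /xz ?eqxx // => z zy.
    by rewrite eq_sym (negbTE zy).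
  rewrite big_seq big1 // => z zs; rewrite /xz; case: eqP => // yz.
  by rewrite yz zs in ys.
apply: sqr_esum_sum => // z _; rewrite -[X in (_ <= X)%E]mule1 -(esum_delta R z).
rewrite -esumZl ?sqr_ge0 //.
apply: le_esum => y _; rewrite -EFinM lee_fin /xz eq_sym.
case: (z == y); last by rewrite normc0 expr0n mulr0.
by rewrite mulr1 ler_sqr ?nnegrE ?normc_ge0.
Qed.

(** The intervals of radius [r n] around [x n] meet pairwise, so the supremum of their left ends
    lies in all of them. *)
Lemma real_limit (x r : nat -> R) : (forall m n, `|x m - x n| <= r m + r n) ->
  exists l, forall n, `|l - x n| <= r n.
Proof.
move=> xr; pose E := [set x n - r n | n in [set: nat]].
have ubE m : ubound E (x m + r m).
  by move=> _ [n _ <-]; have := xr n m; rewrite ler_norml => /andP[_]; lra.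
exists (sup E) => n; rewrite ler_norml; apply/andP; split.
  have : x n - r n <= sup E by apply: ub_le_sup; [exists (x n + r n); exact: ubE|exists n].
  by lra.
have : sup E <= x n + r n by apply: ge_sup; [exists (x 0%N - r 0%N); exists 0%N|exact: ubE].
by lra.
Qed.

Lemma normc_re (z : R[i]) : `|complex.Re z| <= normc z.
Proof.
case: z => a b /=; rewrite -sqrtr_sqr; apply: ler_wsqrtr.
by rewrite lerDl sqr_ge0.
Qed.

Lemma normc_im (z : R[i]) : `|complex.Im z| <= normc z.
Proof.
case: z => a b /=; rewrite -sqrtr_sqr; apply: ler_wsqrtr.
by rewrite lerDr sqr_ge0.
Qed.

Lemma normc_le_reim (z : R[i]) : normc z <= `|complex.Re z| + `|complex.Im z|.
Proof.
case: z => a b /=; rewrite -ler_sqr ?nnegrE ?sqrtr_ge0 ?addr_ge0 //.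
rewrite sqr_sqrtr ?addr_ge0 ?sqr_ge0 // sqrrD !real_normK ?num_real //.
by rewrite lerD2r lerDl mulrn_wge0 // mulr_ge0.
Qed.

Lemma complex_limit (z : nat -> R[i]) (r : nat -> R) :
  (forall m n, normc (z m - z n) <= r m + r n) ->
  exists l, forall n, normc (l - z n) <= 2 * r n.
Proof.
move=> zr.
have [|a aP] := @real_limit (fun n => complex.Re (z n)) r.
  by move=> m n; apply: le_trans (zr m n); rewrite -raddfB normc_re.
have [|b bP] := @real_limit (fun n => complex.Im (z n)) r.
  by move=> m n; apply: le_trans (zr m n); rewrite -raddfB normc_im.
exists (a +i* b)%C => n; apply: le_trans (normc_le_reim _) _.
by rewrite !raddfB [2 * _]mulr_natl mulr2n; exact: lerD (aP n) (bP n).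
Qed.

Lemma small_harmonic (a e : R) : 0 <= a -> 0 < e -> exists n : nat, a * n.+1%:R^-1 <= e.
Proof.
move=> a0 e0; have ae : 0 <= a / e by rewrite divr_ge0 // ltW.
exists (Num.bound (a / e)); rewrite ler_pdivrMr ?ltr0n // mulrC -ler_pdivrMr //.
by apply: le_trans (ltW (archi_boundP ae)) _; rewrite ler_nat.
Qed.

Lemma act_linear u (a : R[i]) (x x' : X -> R[i]) y :
  act u (fun g => a * x g + x' g) y = a * act u x y + act u x' y.
Proof.
by rewrite /act mulr_sumr -big_split; apply: eq_bigr => cg _ /=; ring.
Qed.

Lemma act_bound u : exists2 b : R, 0 < b & op_le u b.
Proof.
pose L := \sum_(cg <- u) normc cg.1.
have L0 : 0 <= L by rewrite sumr_ge0 // => cg _; exact: normc_ge0.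
exists (L + 1) => [|x]; first by rewrite ltr_wpDl.
apply: sqr_esum_scaled => [|A A0 xA]; first by rewrite ltr_wpDl.
apply: (@le_trans _ _ ((L * A) ^+ 2)%:E); last first.
  by rewrite lee_fin ler_sqr ?nnegrE ?mulr_ge0 ?addr_ge0 // ler_wpM2r // lerDl.
rewrite mulr_suml; apply: sqr_esum_sum => [cg|cg _]; first by rewrite mulr_ge0 // normc_ge0.
rewrite sqr_esumZ exprMn [X in (_ <= X)%E]EFinM; apply: lee_wpmul2l.
  by rewrite lee_fin sqr_ge0.
apply: le_trans xA; rewrite [X in (_ <= X)%E](@sqr_esum_reindex _ _ _ (fun y => (cg.2^-1 * y)%g)) //.
by exists (fun y => (cg.2 * y)%g) => y; rewrite ?mulKg ?mulVKg.
Qed.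


(* The limit exists pointwise because the coordinates of [act (w n) x] are Cauchy sequences; Fatou's
   lemma then bounds the distance in norm. *)
Theorem limit_operator (w : nat -> seq (R[i] * X)) :
  (forall m n, op_le (w m ++ opp_sum (w n)) (m.+1%:R^-1 + n.+1%:R^-1)) ->
  exists S : {linear l2 R X -> l2 R X}, forall n, approximates S (w n) (2 * n.+1%:R^-1).
Proof.
move=> cauchy; pose r (n : nat) : R := n.+1%:R^-1.
have r0 n : 0 < r n by rewrite invr_gt0 ltr0n.
pose A (x : l2 R X) := l2_norm x; have A0 x : 0 <= A x by exact: sqrtr_ge0.
have cauchyA (x : l2 R X) m n : (sqr_esum (fun y => (act (w m) x y - act (w n) x y)%R) <=
    (((r m + r n) * A x) ^+ 2)%:E)%E.
  have xA : (sqr_esum x <= (A x ^+ 2)%:E)%E by rewrite sqr_l2_norm.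
  apply: (scaled_le xA); apply: le_trans (cauchy m n x).
  by apply: le_sqr_esum => y; rewrite act_cat act_opp.
have pw (x : l2 R X) y : exists l, forall n, normc (l - act (w n) x y) <= 2 * (r n * A x).
  apply: complex_limit => m n; rewrite -mulrDl -ler_sqr ?nnegrE ?normc_ge0 //; last first.
    by rewrite mulr_ge0 // addr_ge0 // ltW.
  rewrite -lee_fin; apply: le_trans (cauchyA x m n).
  exact: (sqr_esum_ge (fun y => act (w m) x y - act (w n) x y) y).
have [S0 S0P] := choice (fun xy : l2 R X * X => pw xy.1 xy.2).
pose S1 (x : l2 R X) y := S0 (x, y).
have S1P (x : l2 R X) y n : normc (S1 x y - act (w n) x y) <= 2 * (r n * A x) := S0P (x, y) n.
have S1le (x : l2 R X) n : (sqr_esum (fun y => (S1 x y - act (w n) x y)%R) <=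
    ((2 * r n * A x) ^+ 2)%:E)%E.
  apply: sqr_esum_le_fin => s us.
  (* The index [m] depends on the finite set [s]: it brings all errors that involve [r m] below
     [r n], so the final bound [2 r n] is independent of [s]. *)
  have [m mP] := @small_harmonic ((size s)%:R * 2 + 1) (r n) (addr_ge0 (mulr_ge0 (ler0n _ _) (ler0n _ _)) ler01) (r0 n).
  rewrite -/(r m) in mP.
  have b1 := @sqr_esum_restrict s _ _ us (fun y => S1P x y m).
  have b2 : (sqr_esum (fun y => if y \in s then act (w m) x y - act (w n) x y else 0)%R <=
      (((r m + r n) * A x) ^+ 2)%:E)%E.
    apply: le_trans (cauchyA x m n); apply: le_sqr_esum => y.
    by case: ifP => // _; rewrite normc0 normc_ge0.
  have p1 : 0 <= (size s)%:R * (2 * (r m * A x)) by rewrite !mulr_ge0 // ltW.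
  have p2 : 0 <= (r m + r n) * A x by rewrite mulr_ge0 // addr_ge0 // ltW.
  have := sqr_esumD p1 p2 b1 b2.
  rewrite (@eq_sqr_esum _ _ _ (fun y => if y \in s then S1 x y - act (w n) x y else 0)) => [|y].
    move=> /le_trans; apply; rewrite lee_fin ler_sqr ?nnegrE ?addr_ge0 //; last first.
      by rewrite !mulr_ge0 // ltW.
    have -> : (size s)%:R * (2 * (r m * A x)) + (r m + r n) * A x =
        (((size s)%:R * 2 + 1) * r m + r n) * A x by ring.
    by rewrite ler_wpM2r // [2 * _]mulr_natl mulr2n lerD2r.
  by case: ifP => _; rewrite ?addr0 //; congr normc; ring.
have S1l2 (x : l2 R X) : S1 x \in @square_summable R X.
  have : [pred z | `[< (sqr_esum z < +oo)%E >]] (S1 x); last by [].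
  apply/asboolP.
  have a2 : (sqr_esum (act_l2 (w 0%N) x) <= (A (act_l2 (w 0%N) x) ^+ 2)%:E)%E.
    by rewrite sqr_l2_norm.
  have p1 : 0 <= 2 * r 0%N * A x by rewrite !mulr_ge0 // ltW.
  have := sqr_esumD p1 (A0 _) (S1le x 0%N) a2.
  rewrite (@eq_sqr_esum _ _ _ (S1 x)) => [|y]; last by rewrite act_l2E subrK.
  by move=> /le_lt_trans; apply; rewrite ltry.
pose S (x : l2 R X) : l2 R X := L2 (S1l2 x).
have linS : linear S.
  move=> a x x'; apply: val_inj; apply/funext => y.
  apply/eqP; rewrite -subr_eq0; apply/eqP; apply: normc_le0 => e e0.
  rewrite -[val _ y]/(S1 (a *: x + x') y) -[X in normc (_ - X)]/(a * S1 x y + S1 x' y).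
  pose K := 2 * (A (a *: x + x') + normc a * A x + A x').
  have K0 : 0 <= K by rewrite mulr_ge0 // !addr_ge0 // mulr_ge0 // normc_ge0.
  have [n nP] := small_harmonic K0 e0; apply: le_trans nP; rewrite -/(r n).
  (* As [act (w n)] is linear, the defect of linearity only involves the distances from [S1] to
     [act (w n)], which tend to 0. *)
  have -> : S1 (a *: x + x') y - (a * S1 x y + S1 x' y) =
      (S1 (a *: x + x') y - act (w n) (a *: x + x') y)
      + (- (a * (S1 x y - act (w n) x y)) - (S1 x' y - act (w n) x' y)).
    by rewrite -[act (w n) (a *: x + x') y]/(act (w n) (fun g => a * x g + x' g) y) act_linear; ring.
  have := S1P (a *: x + x') y n; have := S1P x y n; have := S1P x' y n => l1 l2 l3.
  apply: le_trans (le_normcD _ _) _; apply: (@le_trans _ _ (2 * (r n * A (a *: x + x')) +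
    (normc a * (2 * (r n * A x)) + 2 * (r n * A x')))); last first.
    by rewrite le_eqVlt /K; apply/orP; left; apply/eqP; ring.
  apply: lerD => //; apply: le_trans (le_normcD _ _) _; rewrite !normcN normcM.
  by apply: lerD => //; rewrite ler_wpM2l // normc_ge0.
pose Sl : {linear l2 R X -> l2 R X} := HB.pack S (GRing.isLinear.Build _ _ _ _ S linS).
exists Sl => n x; rewrite -sqr_l2_norm -EFinM -exprMn; exact: S1le.
Qed.

End limit_operators.

(** * From formal sums back to finitely supported functions *)

Section finitely_supported.
Variables (R : realType) (X : groupType).

Lemma act_l2_left_regular (u : seq (R[i] * X)) :
  exists f : {fsfun X -> R[i] with 0}, forall x, left_regular f x = act_l2 u x.
Proof.
pose D := [fset g in [seq cg.2 | cg <- u]]%fset.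
pose f := [fsfun g in D => \sum_(cg <- u | cg.2 == g) cg.1 | 0] : {fsfun X -> R[i] with 0}.
exists f => x; apply: val_inj; apply/funext => y.
rewrite left_regularE -[val _ y]/(act_l2 _ x y) act_l2E -[RHS]/(act_l2 u x y) act_l2E.
have fD g : g \notin D -> f g = 0 by move=> gD; rewrite fsfunE (negbTE gD).
have fE g : f g = \sum_(cg <- u | cg.2 == g) cg.1.
  rewrite fsfunE; case: ifP => // gD; rewrite big_seq_cond big1 // => cg /andP[cgu /eqP cgg].
  by move: gD; rewrite !inE -cgg map_f.
rewrite /act big_map /=.
have -> : \sum_(g <- finsupp f) f g * x (g^-1 * y)%g = \sum_(g <- D) f g * x (g^-1 * y)%g.
  apply: big_fset_incl => [|g _ gf].
    apply/fsubsetP => g; rewrite mem_finsupp => fg.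
    by apply/negPn/negP => gD; move: fg; rewrite fD ?eqxx.
  by move: gf; rewrite memNfinsupp => /eqP ->; rewrite mul0r.
transitivity (\sum_(g <- D) \sum_(cg <- u | cg.2 == g) cg.1 * x (g^-1 * y)%g).
  by apply: eq_bigr => g _; rewrite fE mulr_suml.
rewrite (exchange_big_dep predT) //= [RHS]big_seq [LHS]big_seq; apply: eq_bigr => cg cgu.
rewrite big_mkcond (bigD1_seq cg.2) ?fset_uniq //=; last by rewrite !inE map_f.
by rewrite eqxx big1 ?addr0 // => g gc; rewrite eq_sym (negbTE gc).
Qed.

End finitely_supported.

(** * The trivial character and the image of an idempotent in C*_r(H) *)

Section pushforward.
Variables (R : realType) (N H G : groupType).
Variables (i : {multiplicative N -> G}) (p : {multiplicative G -> H}).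
Variables (sigma : H -> G) (nu : G -> N).
Hypothesis i_inj : injective i.
Hypothesis i_central : forall n g, (i n * g = g * i n)%g.
Hypothesis pi1 : forall n, p (i n) = 1%g.
Hypothesis psigma : forall h, p (sigma h) = h.
Hypothesis decomp : forall y, y = (i (nu y) * sigma (p y))%g.
Hypothesis comN : abelian_group N.
Hypothesis tfN : torsion_free N.
Hypothesis amH : amenable R H.

Definition push (u : seq (R[i] * G)) : seq (R[i] * H) := [seq (cg.1, p cg.2) | cg <- u].

Lemma act_push u (f : H -> R[i]) y : act (push u) f (p y) = act u (fun z => f (p z)) y.
Proof.
by rewrite /act big_map; apply: eq_bigr => cg _; rewrite gmulfM multiplicativeV.
Qed.

Lemma push_cat u v : push (u ++ v) = push u ++ push v.
Proof. exact: map_cat. Qed.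

Lemma push_opp u : push (opp_sum u) = opp_sum (push u).
Proof. by rewrite /push /opp_sum -!map_comp. Qed.

Lemma trivial_character : @character R N (fun=> 1).
Proof. by split=> [x y|x]; rewrite ?mulr1 ?normc1. Qed.

(** Functions equivariant for the trivial character are those that factor through [p]; this
    identifies the fibre at 1 with functions on H. *)
Lemma op_le_push u (b : R) : fibre_le i sigma (fun=> 1) u b -> op_le (push u) b.
Proof.
move=> ub f; have ef : @equivariant R N G i (fun=> 1) (fun z => f (p z)).
  by move=> n y; rewrite (p_mul_i pi1) mul1r.
have := ub _ ef; congr (_ <= _ * _)%E; apply: eq_sqr_esum => h; last by rewrite psigma.
by rewrite -act_push psigma.
Qed.

Lemma fibre_le_push u (b : R) : op_le (push u) b -> fibre_le i sigma (fun=> 1) u b.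
Proof.
move=> ub x ex; have xE y : x y = x (sigma (p y)) by rewrite {1}(decomp y) ex mul1r.
have := ub (fun h => x (sigma h)); congr (_ <= _)%E; apply: eq_sqr_esum => h.
rewrite -{1}(psigma h) act_push; congr normc; apply: eq_bigr => cg _.
by rewrite [in RHS]xE.
Qed.

Lemma op_le_pushforward u (b c : R) : 0 <= b -> b < c -> op_le u b -> op_le (push u) c.
Proof.
move=> b0 bc ub; apply: op_le_push; have s0 : 0 < c - b by rewrite subr_gt0.
have := op_le_fibre i_inj i_central pi1 psigma decomp comN amH trivial_character b0 s0 ub.
by rewrite addrC subrK.
Qed.

Section idempotent.
Variable (T : {linear l2 R G -> l2 R G}) (M : R).
Hypothesis TT : T \o T =1 T.
Hypothesis M0 : 0 < M.
Hypothesis TM : op_bound T M.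
Hypothesis Tapprox : forall e, 0 < e -> exists u, approximates T u e.

(** [S] is the image of [T] under the map from C*_r(G) to C*_r(H) induced by [p]. *)
Lemma push_limit : exists S : {linear l2 R H -> l2 R H},
  forall e, 0 < e -> exists u, approximates T u e /\ approximates S (push u) e.
Proof.
have hn0 (n : nat) : 0 < n.+1%:R^-1 :> R by rewrite invr_gt0 ltr0n.
(* Halving leaves room for the strict inequality in [op_le_pushforward]. *)
have dn0 (n : nat) : 0 < n.+1%:R^-1 / 2 :> R by rewrite divr_gt0.
have [u uT] := choice (fun n => Tapprox (dn0 n)).
have [|S Su] := @limit_operator R H (fun n => push (u n)).
  move=> m n; rewrite -push_opp -push_cat.
  apply: (@op_le_pushforward _ (m.+1%:R^-1 / 2 + n.+1%:R^-1 / 2)).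
  - by rewrite addr_ge0 // ltW.
  - by move: (hn0 m) (hn0 n); move: (m.+1%:R^-1) (n.+1%:R^-1) => a b; lra.
  - exact: approximates_sub.
exists S => e e0; have [n ne] := @small_harmonic R 2 e (ler0n _ _) e0.
exists (u n); split; last by apply: approximatesW ne (Su n); rewrite mulr_ge0 // ltW.
apply: approximatesW (uT n); first exact: ltW.
by apply: le_trans ne; move: (hn0 n); move: (n.+1%:R^-1) => q; lra.
Qed.

Lemma approximates_bounded (X : groupType) (S : l2 R X -> l2 R X) (v : seq (R[i] * X)) (e : R) :
  0 < e -> approximates S v e -> exists2 B : R, 0 < B & op_bound S B.
Proof.
move=> e0 Sv; have [b b0 vb] := act_bound v.
exists (e + b) => [|x]; first exact: addr_gt0.
apply: sqr_esum_scaled => [|A A0 xA]; first exact: addr_gt0.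
rewrite (@eq_sqr_esum _ _ _ (fun y => (S x y - act v x y) + act v x y)) => [|y]; last first.
  by rewrite subrK.
rewrite mulrDl; apply: sqr_esumD; rewrite ?mulr_ge0 ?(ltW e0) ?(ltW b0) //.
  exact: (scaled_le xA (Sv x)).
exact: (scaled_le xA (vb x)).
Qed.

Lemma push_limit_idempotent (S : {linear l2 R H -> l2 R H}) :
  (forall e, 0 < e -> exists u, approximates T u e /\ approximates S (push u) e) ->
  S \o S =1 S.
Proof.
move=> Su; have [u1 [_ Su1]] := Su 1 ltr01.
have [B B0 SB] := approximates_bounded ltr01 Su1.
move=> x; apply: val_inj; apply/funext => h; apply/eqP; rewrite -subr_eq0; apply/eqP.
apply: normc_le0 => e e0; pose A := l2_norm x; have A0 : 0 <= A by exact: sqrtr_ge0.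
have xA : (sqr_esum x <= (A ^+ 2)%:E)%E by rewrite sqr_l2_norm.
(* [K] adds up the four errors in the decomposition [E], in units of [d A]: [B], [B + 1],
   [M + M + 3] and 1. *)
pose K := B + B + M + M + 5; have K0 : 0 < K by rewrite !addr_gt0.
have KA0 : 0 <= K * A by rewrite mulr_ge0 // ltW.
have [n nK] := small_harmonic KA0 e0; pose d : R := n.+1%:R^-1.
have d0 : 0 < d by rewrite invr_gt0 ltr0n.
have d1 : d <= 1 by rewrite invf_le1 ?ltr0n // ler1n.
have [u [Tu Sud]] := Su d d0.
have dA0 : 0 <= d * A by rewrite mulr_ge0 // ltW.
pose wx := act_l2 (push u) x.
have Sxw : (sqr_esum (S x - wx : l2 R H)%R <= ((d * A) ^+ 2)%:E)%E.
  apply: le_trans (scaled_le xA (Sud x)); apply: le_sqr_esum => y.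
  by rewrite -act_l2E.
have SSxw : (sqr_esum (S (S x - wx)%R) <= ((B * (d * A)) ^+ 2)%:E)%E.
  exact: (scaled_le Sxw (SB _)).
have wxA : (sqr_esum wx <= (((B + 1) * A) ^+ 2)%:E)%E.
  rewrite (@eq_sqr_esum _ _ _ (fun y => S x y - (S x - wx : l2 R H) y)) => [|y]; last first.
    by rewrite -[(S x - wx : l2 R H) y]/(S x y - wx y) opprB addrC subrK.
  apply: (@le_trans _ _ ((B * A + d * A) ^+ 2)%:E).
    by apply: sqr_esumB => //; [rewrite mulr_ge0 // ltW|exact: (scaled_le xA (SB x))].
  have BA0 : 0 <= B * A by rewrite mulr_ge0 // ltW.
  by rewrite lee_fin mulrDl ler_sqr ?nnegrE ?addr_ge0 ?mul1r // lerD2l ler_piMl.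
have Swx : (sqr_esum (fun y => (S wx y - act (push u) wx y)%R) <= ((d * ((B + 1) * A)) ^+ 2)%:E)%E.
  exact: (scaled_le wxA (Sud wx)).
have Mp : 0 <= d * (M + M + 2) by rewrite mulr_ge0 ?addr_ge0 // ltW.
have uu := idempotent_approximation TT M0 TM d0 d1 Tu.
have := @op_le_pushforward _ _ (d * (M + M + 3)) Mp _ uu.
rewrite ltr_pM2l // ltrD2l ltr_nat => /(_ isT) puu.
have wwx : (sqr_esum (fun y => (act (push u) wx y - wx y)%R) <= ((d * (M + M + 3) * A) ^+ 2)%:E)%E.
  apply: (scaled_le xA); apply: le_trans (puu x); apply: le_sqr_esum => y.
  have [z <-] : exists z, p z = y by exists (sigma y).
  have -> : act (push u) wx (p z) - wx (p z) = act (push (mul_sum u u ++ opp_sum u)) x (p z).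
    rewrite [RHS]act_push act_cat act_opp act_mul [wx (p z)]act_l2E act_push act_push.
    congr (_ - _); apply: eq_bigr => cg _; congr (_ * _).
    by rewrite act_l2E act_push.
  exact: lexx.
have E y : (S (S x) - S x : l2 R H) y = S (S x - wx) y + (S wx y - act (push u) wx y)
     + (act (push u) wx y - wx y) - (S x - wx : l2 R H) y.
  rewrite linearB -[(S (S x) - S wx : l2 R H) y]/(S (S x) y - S wx y).
  by rewrite -[(S x - wx : l2 R H) y]/(S x y - wx y) -[LHS]/(S (S x) y - S x y); ring.
have p1 : 0 <= B * (d * A) by rewrite mulr_ge0 // ltW.
have p2 : 0 <= d * ((B + 1) * A) by rewrite !mulr_ge0 ?addr_ge0 // ltW.
have p3 : 0 <= d * (M + M + 3) * A by rewrite !mulr_ge0 ?addr_ge0 // ltW.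
have s12 := sqr_esumD p1 p2 SSxw Swx.
have s123 := sqr_esumD (addr_ge0 p1 p2) p3 s12 wwx.
have s := sqr_esumB (addr_ge0 (addr_ge0 p1 p2) p3) dA0 s123 Sxw.
rewrite -(eq_sqr_esum (fun y => congr1 _ (E y))) in s.
have := le_trans (sqr_esum_ge _ h) s.
rewrite lee_fin ler_sqr ?nnegrE ?normc_ge0 //; last by rewrite !addr_ge0.
move=> /le_trans; apply; apply: le_trans nK.
by rewrite le_eqVlt -/d /K; apply/orP; left; apply/eqP; ring.
Qed.

Lemma push_limit_reduced (S : {linear l2 R H -> l2 R H}) :
  (forall e, 0 < e -> exists u, approximates T u e /\ approximates S (push u) e) ->
  reduced_group_Cstar S.
Proof.
move=> Su; split.
  have [u1 [_ Su1]] := Su 1 ltr01.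
  have [B B0 SB] := approximates_bounded ltr01 Su1.
  by exists B => x; rewrite l2_norm_le // ltW.
move=> e e0; have [u [_ Su']] := Su e e0.
have [f fE] := act_l2_left_regular (push u); exists f => x.
rewrite l2_norm_le ?(ltW e0) //; apply: le_trans (Su' x); apply: le_sqr_esum => y.
by rewrite fE -act_l2E.
Qed.

Lemma fibre_le_limit (S : l2 R H -> l2 R H) u (e : R) : 0 < e ->
  S =1 (fun=> 0) -> approximates S (push u) e -> fibre_le i sigma (fun=> 1) u e.
Proof.
move=> e0 S0 Su; apply: fibre_le_push; apply: op_le_l2 => // x.
apply: le_trans (Su x); apply: le_sqr_esum => y.
by rewrite S0 -[(0 : l2 R H) y]/(0 : R[i]) sub0r normcN.
Qed.

End idempotent.

Lemma idempotent_trivial (T : {linear l2 R G -> l2 R G}) :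
  (forall S : {linear l2 R H -> l2 R H}, reduced_group_Cstar S ->
     S \o S =1 S -> S =1 (fun=> 0) \/ S =1 id) ->
  reduced_group_Cstar T -> T \o T =1 T -> T =1 (fun=> 0) \/ T =1 id.
Proof.
move=> KK [Tb Tapp] TT; have [M M0 TM] := bounded_op_bound Tb.
have Tapprox e : 0 < e -> exists u, approximates T u e.
  move=> e0; have [f fT] := Tapp e e0; exists [seq (f g, g) | g <- finsupp f] => x.
  have := fT x; rewrite l2_norm_le ?(ltW e0) // => /(le_trans _); apply.
  by apply: le_sqr_esum => y; rewrite left_regularE -act_l2E.
have [S Su] := push_limit Tapprox.
have [S0|S1] := KK S (push_limit_reduced Su) (push_limit_idempotent TT M0 TM Su).
  left; apply: (zero_of_vanishing i_inj i_central pi1 psigma decomp comN tfN amH TT M0 TM Tapprox).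
  move=> e e0; have [u [Tu Suu]] := Su e e0; exists u => //.
  exact: fibre_le_limit S0 Suu.
right; pose U : {linear l2 R G -> l2 R G} := idfun \- T.
have UE x : U x = x - T x by [].
have UU : U \o U =1 U.
  by move=> x; rewrite -[LHS]/(U (U x)) !UE linearB -[T (T x)]/((T \o T) x) TT subrr subr0.
pose one : seq (R[i] * G) := [:: (1, 1%g)].
have act1 (X : groupType) (x : X -> R[i]) y : act [:: (1, 1%g)] x y = x y.
  by rewrite /act big_seq1 /= invg1 mul1g mul1r.
have Uu u e : approximates T u e -> approximates U (one ++ opp_sum u) e.
  move=> Tu x; apply: le_trans (Tu x); apply: le_sqr_esum => y.
  rewrite act_cat act1 act_opp UE -[(x - T x : l2 R G) y]/(x y - T x y).
  by rewrite -normcN le_eqVlt; apply/orP; left; apply/eqP; congr normc; ring.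
have Uapprox e : 0 < e -> exists u, approximates U u e.
  by move=> e0; have [u Tu] := Tapprox e e0; exists (one ++ opp_sum u); exact: Uu.
have [u1 U1] := Uapprox 1 ltr01.
have [M' M'0 UM] := approximates_bounded ltr01 U1.
have := zero_of_vanishing i_inj i_central pi1 psigma decomp comN tfN amH UU M'0 UM Uapprox.
have vU : vanishes_at i sigma U (fun=> 1).
  move=> e e0; have [u [Tu Suu]] := Su e e0; exists (one ++ opp_sum u); first exact: Uu.
  (* The image of [U] in C*_r(H) is [1 - S = 0], approximated by the pushed sum. *)
  apply: (@fibre_le_limit (fun=> 0)) => // x; apply: le_trans (Suu x); apply: le_sqr_esum => y.
  rewrite push_cat push_opp act_cat act_opp S1 [push one]/= multiplicative1 act1.
  by rewrite -[(0 : l2 R H) y]/(0 : R[i]) sub0r normcN.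
by move=> /(_ vU) U0 x; apply/eqP; rewrite eq_sym -subr_eq0 -UE U0.
Qed.

End pushforward.

(** A torsion element of G maps to 1 in H, hence comes from a torsion element of N. *)
Lemma torsion_free_extension (N H G : groupType) (i : {multiplicative N -> G})
    (p : {multiplicative G -> H}) : injective i -> range i = p @^-1` [set 1%g] ->
  torsion_free N -> torsion_free H -> torsion_free G.
Proof.
move=> inj_i exact_i tfN tfH g n n0 gn.
have mulX (A B : groupType) (f : {multiplicative A -> B}) x k : f (x ^+ k)%g = (f x ^+ k)%g.
  by elim: k => [|k IH]; rewrite ?expg0 ?multiplicative1 // !expgS gmulfM IH.
have pg : p g = 1%g by apply: (tfH _ n n0); rewrite -mulX gn multiplicative1.
have : range i g by rewrite exact_i.
move=> [m _ mg]; rewrite -mg (tfN m n n0) ?multiplicative1 //.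
by apply: inj_i; rewrite mulX mg gn multiplicative1.
Qed.

Theorem corollary4p2 (R : realType) (N H G : groupType) :
  torsion_free N -> torsion_free H ->
  countable [set: N] -> countable [set: H] ->
  abelian_group N ->
  amenable R H ->
  is_central_extension N H G ->
  Kadison_Kaplansky R H -> Kadison_Kaplansky R G.
Proof.
move=> tfN tfH _ _ comN amH [i [p [i_inj exact_i p_surj i_central]]] [_ KK].
split; first exact: torsion_free_extension i_inj exact_i tfN tfH.
have pi1 n : p (i n) = 1%g.
  have : (p @^-1` [set 1%g]) (i n) by rewrite -exact_i; exists n.
  by [].
have lift h : exists y, p y = h.
  have : range p h by rewrite p_surj.
  by move=> [y _ yh]; exists y.
(* [sigma] is only a section of sets; its failure to be multiplicative is the cocycle recorded by
   [nu]. *)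
have [sigma psigma] := choice lift.
have coset y : exists n, y = (i n * sigma (p y))%g.
  have : range i (y * (sigma (p y))^-1)%g.
    by rewrite exact_i /= gmulfM multiplicativeV psigma mulgV.
  by move=> [n _ ny]; exists n; rewrite ny -mulgA mulVg mulg1.
have [nu decomp] := choice coset.
move=> T; exact: (idempotent_trivial i_inj i_central pi1 psigma decomp comN tfN amH KK).
Qed.
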